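(* For every $n\ge0$, there exists a ring structure on the abelian group $K_{0}(C(\mathsf{CP}_q^{n}))$ whose multiplication satisfies $$[L_j][L_k]=[L_{j+k}]\qquad\forall\;j,k\in\mathbb{Z}.$$
   Context: $C(\mathsf{S}^{2n+1}_q)$ (Vaksman–Soibelman quantum sphere) is identified with the graph C*-algebra of the graph $\Lambda_{2n+1}$ with vertices $v_0,\dots,v_n$ and exactly one edge $e_{ij}:v_i\to v_j$ for each $0\le i\le j\le n$; i.e. the universal C*-algebra generated by mutually orthogonal projections $P_{v_i}$ and partial isometries $S_{e_{ij}}$ with $S_{e_{ij}}^*S_{e_{ij}}=P_{v_j}$ and $\sum_{j=i}^nS_{e_{ij}}S_{e_{ij}}^*=P_{v_i}$. The gauge action of $U(1)$ is $\gamma_\lambda(S_e)=\lambda S_e$, $\gamma_\lambda(P_v)=P_v$, and $C(\mathsf{CP}_q^n):=C(\mathsf{S}^{2n+1}_q)^{U(1)}$. For $k\in\mathbb{Z}$, $L_k:=\{a\in C(\mathsf{S}^{2n+1}_q):\gamma_\lambda(a)=\lambda^ka\ \forall\lambda\in U(1)\}$. Since the gauge action is free, $L_k$ is a finitely generated projective left $C(\mathsf{CP}_q^n)$-module, hence defines a class $[L_k]\in K_0(C(\mathsf{CP}_q^n))$. *)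

(* Defs.v *)
From HB Require Import structures.
From mathcomp Require Import all_boot all_order all_algebra.
From mathcomp Require Import generic_quotient complex.
From mathcomp Require Import all_classical all_reals all_analysis.

Set Implicit Arguments.
Unset Strict Implicit.
Unset Printing Implicit Defensive.
Import Order.TTheory GRing.Theory Num.Theory.
Import numFieldNormedType.Exports.
Local Open Scope classical_set_scope.
Local Open Scope quotient_scope.
Local Open Scope ring_scope.

Section Grothendieck.
Variable V : nmodType.

(* [(a, b)] stands for the formal difference [a - b]. *)
Definition groth_rel (x y : V * V) : bool :=
  `[< exists z : V, x.1 + y.2 + z = y.1 + x.2 + z >].

Lemma groth_rel_refl : reflexive groth_rel.
Proof. by move=> x; apply/asboolP; exists 0. Qed.

Lemma groth_rel_sym : symmetric groth_rel.
Proof. by move=> x y; apply/asboolP/asboolP => -[z e]; exists z. Qed.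

Lemma groth_rel_trans : transitive groth_rel.
Proof.
move=> y x w /asboolP[z e] /asboolP[t f]; apply/asboolP.
exists (y.1 + y.2 + z + t).
have -> : x.1 + w.2 + (y.1 + y.2 + z + t)
          = (x.1 + y.2 + z) + (y.1 + w.2 + t).
  by rewrite [LHS](AC (2*4) ((1*4*5)*(3*2*6))).
by rewrite e f [LHS](AC (3*3) ((4*2)*(1*5*3*6))).
Qed.

Canonical groth_equiv :=
  EquivRel groth_rel groth_rel_refl groth_rel_sym groth_rel_trans.

Definition groth := {eq_quot groth_rel}.
HB.instance Definition _ := Choice.on groth.

Lemma groth_eqP (x y : V * V) :
  reflect (exists z, x.1 + y.2 + z = y.1 + x.2 + z)
          (\pi_groth x == \pi_groth y).
Proof.
rewrite (_ : _ == _ = groth_rel x y); first exact: asboolP.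
by rewrite piE.
Qed.

Definition groth_zero : groth := \pi_groth (0, 0).
Definition groth_opp (x : groth) : groth := \pi_groth ((repr x).2, (repr x).1).
Definition groth_add (x y : groth) : groth :=
  \pi_groth ((repr x).1 + (repr y).1, (repr x).2 + (repr y).2).

Lemma groth_oppE (a b : V) : groth_opp (\pi_groth (a, b)) = \pi_groth (b, a).
Proof.
apply/eqP/groth_eqP => /=.
have /eqP/groth_eqP[z e] : \pi_groth (repr (\pi_groth (a, b))) = \pi_groth (a, b).
  by rewrite reprK.
by exists z; move: e => /= e; rewrite ![_.2 + _]addrC [b + _]addrC.
Qed.

Lemma groth_addE (a b c d : V) :
  groth_add (\pi_groth (a, b)) (\pi_groth (c, d)) = \pi_groth (a + c, b + d).
Proof.
apply/eqP/groth_eqP => /=.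
have /eqP/groth_eqP[z e] : \pi_groth (repr (\pi_groth (a, b))) = \pi_groth (a, b).
  by rewrite reprK.
have /eqP/groth_eqP[t f] : \pi_groth (repr (\pi_groth (c, d))) = \pi_groth (c, d).
  by rewrite reprK.
move: e f => /=; set x := repr _; set y := repr _ => e f.
exists (z + t).
by rewrite (addrACA x.1) (addrACA (x.1 + b)) e f (addrACA a) (addrACA (a + x.2)).
Qed.

Lemma groth_ind (Q : groth -> Prop) :
  (forall a b, Q (\pi_groth (a, b))) -> forall x, Q x.
Proof. by move=> h x; rewrite -[x]reprK; case: (repr x). Qed.

Lemma groth_addA : associative groth_add.
Proof.
elim/groth_ind => a b; elim/groth_ind => c d; elim/groth_ind => e f.
by rewrite !groth_addE !addrA.
Qed.

Lemma groth_addC : commutative groth_add.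
Proof.
elim/groth_ind => a b; elim/groth_ind => c d.
by rewrite !groth_addE [a + c]addrC [b + d]addrC.
Qed.

Lemma groth_add0 : left_id groth_zero groth_add.
Proof. by elim/groth_ind => a b; rewrite groth_addE !add0r. Qed.

Lemma groth_addN : left_inverse groth_zero groth_opp groth_add.
Proof.
elim/groth_ind => a b; rewrite groth_oppE groth_addE; apply/eqP/groth_eqP => /=.
by exists 0; rewrite !addr0 add0r addrC.
Qed.

HB.instance Definition _ :=
  GRing.isZmodule.Build groth groth_addA groth_addC groth_add0 groth_addN.

Definition groth_of (a : V) : groth := \pi_groth (a, 0).

End Grothendieck.

Section Modules.
Variable B : pzRingType.

Definition mod_iso (M N : lmodType B) : Prop :=
  exists f : M -> N, linear f /\ bijective f.

Definition mod_fg (M : lmodType B) : Prop :=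
  exists (m : nat) (p : {linear 'rV[B]_m -> M}), forall x, exists v, p v = x.

Definition mod_projective (M : lmodType B) : Prop :=
  forall (X Y : lmodType B) (g : {linear X -> Y}) (h : {linear M -> Y}),
    (forall y, exists x, g x = y) ->
    exists k : {linear M -> X}, forall x, g (k x) = h x.

Definition mod_fgp (M : lmodType B) : Prop := mod_fg M /\ mod_projective M.

Lemma mod_iso_refl M : mod_iso M M.
Proof. by exists id; split => //; exists id. Qed.

Lemma mod_iso_sym M N : mod_iso M N -> mod_iso N M.
Proof.
move=> [f [fl [g fK gK]]]; exists g; split; last by exists f.
by move=> a x y; apply: (can_inj fK); rewrite gK fl !gK.
Qed.

Lemma mod_iso_trans M N P : mod_iso M N -> mod_iso N P -> mod_iso M P.
Proof.
move=> [f [fl fb]] [g [gl gb]]; exists (g \o f); split; last exact: bij_comp.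
by move=> a x y; rewrite /= fl gl.
Qed.

Lemma mod_iso_prod (M N M' N' : lmodType B) :
  mod_iso M M' -> mod_iso N N' -> mod_iso (M * N)%type (M' * N')%type.
Proof.
move=> [f [fl [f' fK f'K]]] [g [gl [g' gK g'K]]].
exists (fun x => (f x.1, g x.2)); split.
  by move=> a [x1 x2] [y1 y2]; rewrite /= fl gl.
by exists (fun x => (f' x.1, g' x.2)) => -[x y] /=;
  rewrite ?fK ?gK ?f'K ?g'K.
Qed.

Lemma mod_iso_prodC (M N : lmodType B) : mod_iso (M * N)%type (N * M)%type.
Proof.
exists (fun x => (x.2, x.1)); split; first by move=> a [x1 x2] [y1 y2].
by exists (fun x => (x.2, x.1)) => -[x y].
Qed.

Lemma mod_iso_prodA (M N P : lmodType B) :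
  mod_iso (M * (N * P))%type (M * N * P)%type.
Proof.
exists (fun x => ((x.1, x.2.1), x.2.2)); split.
  by move=> a [x1 [x2 x3]] [y1 [y2 y3]].
by exists (fun x => (x.1.1, (x.1.2, x.2))) => [[x [y z]]|[[x y] z]].
Qed.

(* The idempotent matrix [e] is a code for the module [idem_mod e] of row
   vectors [v] with [v *m e = v], a direct summand of ['rV_m]. Every finitely
   generated projective module is isomorphic to such a module (see [fgp_code]
   below), and, unlike the modules themselves, the codes form a small type. *)
Record idem := Idem {
  idem_size : nat;
  idem_mx :> 'M[B]_idem_size;
  idemP : idem_mx *m idem_mx = idem_mx }.

HB.instance Definition _ := gen_eqMixin idem.
HB.instance Definition _ := gen_choiceMixin idem.

Section IdemMod.
Variable e : idem.

Definition idem_fix : {pred 'rV[B]_(idem_size e)} :=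
  fun v => v *m idem_mx e == v.

Lemma idem_fix_closed : submod_closed idem_fix.
Proof.
split; first by rewrite unfold_in mul0mx.
move=> a u v; rewrite !unfold_in => /eqP eu /eqP ev.
by rewrite mulmxDl -scalemxAl eu ev.
Qed.
HB.instance Definition _ := GRing.isSubmodClosed.Build B 'rV[B]_(idem_size e)
  idem_fix idem_fix_closed.

Record idem_mod := IdemMod {
  idem_val : 'rV[B]_(idem_size e);
  _ : idem_val \in idem_fix }.

HB.instance Definition _ := [isSub for idem_val].
HB.instance Definition _ := [Choice of idem_mod by <:].
HB.instance Definition _ := [SubChoice_isSubLmodule of idem_mod by <:].

Lemma idem_val_inj : injective idem_val.
Proof. exact: val_inj. Qed.

Lemma idem_valP (v : idem_mod) : idem_val v *m idem_mx e = idem_val v.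
Proof. by case: v => v /= /eqP. Qed.

Lemma idem_val_linear : linear idem_val.
Proof. by []. Qed.

End IdemMod.
Arguments idem_fix : clear implicits.

Lemma fgp_code (M : lmodType B) :
  mod_fgp M -> exists e : idem, mod_iso M (idem_mod e).
Proof.
move=> [[m [p psurj]] /(_ _ _ p idfun psurj)[i iK]].
have e_idem : lin1_mx (i \o p) *m lin1_mx (i \o p) = lin1_mx (i \o p).
  apply/row_matrixP => j; rewrite row_mul mul_rV_lin1 /= !rowE.
  by rewrite mul_rV_lin1 /= iK.
pose e := Idem e_idem; exists e.
have inE x : i x \in idem_fix e.
  by rewrite unfold_in /= mul_rV_lin1 /= iK.
exists (fun x => IdemMod (inE x)); split.
  by move=> a x y; apply: idem_val_inj; rewrite /= linearP.
exists (fun v : idem_mod e => p (idem_val v)) => [x|v] /=; first by rewrite iK.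
apply: idem_val_inj => /=.
by have := idem_valP v; rewrite /= mul_rV_lin1.
Qed.

Lemma idem0P : (0 : 'M[B]_0) *m (0 : 'M[B]_0) = 0.
Proof. exact: mulmx0. Qed.
Definition idem0 := Idem idem0P.

Lemma idem_addP (e f : idem) :
  block_mx (idem_mx e) 0 0 (idem_mx f) *m block_mx (idem_mx e) 0 0 (idem_mx f)
  = block_mx (idem_mx e) 0 0 (idem_mx f).
Proof.
by rewrite mulmx_block !mul0mx !mulmx0 !idemP !addr0 !add0r.
Qed.
Definition idem_add (e f : idem) := Idem (idem_addP e f).

Lemma idem_mod_add (e f : idem) :
  mod_iso (idem_mod (idem_add e f)) (idem_mod e * idem_mod f)%type.
Proof.
apply: mod_iso_sym.
have inE (x : idem_mod e * idem_mod f) :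
    row_mx (idem_val x.1) (idem_val x.2) \in idem_fix (idem_add e f).
  by rewrite unfold_in /= mul_row_block !mulmx0 addr0 add0r !idem_valP.
exists (fun x => IdemMod (inE x)); split.
  move=> a x y; apply: idem_val_inj => /=.
  by rewrite -add_row_mx scale_row_mx.
have fixP (v : idem_mod (idem_add e f)) :
    lsubmx (idem_val v) \in idem_fix e /\ rsubmx (idem_val v) \in idem_fix f.
  have := idem_valP v; rewrite /= -[X in X *m _](@hsubmxK _ 1).
  rewrite mul_row_block !mulmx0 addr0 add0r => h.
  by rewrite !unfold_in -[X in _ == lsubmx X]h -[X in _ == rsubmx X]h
    row_mxKl row_mxKr.
exists (fun v => (IdemMod (proj1 (fixP v)), IdemMod (proj2 (fixP v)))).
  by move=> [x y]; congr pair; apply: idem_val_inj; rewrite /= ?row_mxKl ?row_mxKr.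
by move=> v; apply: idem_val_inj; rewrite /= hsubmxK.
Qed.

Lemma idem_mod_add0 (e : idem) :
  mod_iso (idem_mod idem0 * idem_mod e)%type (idem_mod e).
Proof.
exists snd; split; first by move=> a [x1 x2] [y1 y2].
exists (fun y => (0, y)) => // -[x y] /=.
by congr pair; apply: idem_val_inj; rewrite [LHS]thinmx0 [RHS]thinmx0.
Qed.

Definition idem_iso (e f : idem) : bool :=
  `[< mod_iso (idem_mod e) (idem_mod f) >].

Lemma idem_iso_refl : reflexive idem_iso.
Proof. by move=> e; apply/asboolP; exact: mod_iso_refl. Qed.

Lemma idem_iso_sym : symmetric idem_iso.
Proof. by move=> e f; apply/asboolP/asboolP; exact: mod_iso_sym. Qed.

Lemma idem_iso_trans : transitive idem_iso.
Proof.
move=> f e g /asboolP h /asboolP k; apply/asboolP; exact: mod_iso_trans h k.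
Qed.

Canonical idem_equiv :=
  EquivRel idem_iso idem_iso_refl idem_iso_sym idem_iso_trans.

(* The monoid of isomorphism classes of f.g. projective left modules. *)
Definition Vmon := {eq_quot idem_iso}.
HB.instance Definition _ := Choice.on Vmon.

Lemma Vmon_eqP (e f : idem) :
  reflect (mod_iso (idem_mod e) (idem_mod f)) (\pi_Vmon e == \pi_Vmon f).
Proof.
rewrite (_ : _ == _ = idem_iso e f); first exact: asboolP.
by rewrite piE.
Qed.

Definition Vmon_add (x y : Vmon) : Vmon := \pi_Vmon (idem_add (repr x) (repr y)).

Lemma idem_add_iso e f e' f' :
  mod_iso (idem_mod e) (idem_mod e') -> mod_iso (idem_mod f) (idem_mod f') ->
  mod_iso (idem_mod (idem_add e f)) (idem_mod (idem_add e' f')).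
Proof.
move=> h k; apply: mod_iso_trans (idem_mod_add e f) _.
apply: mod_iso_trans (mod_iso_prod h k) _.
exact/mod_iso_sym/idem_mod_add.
Qed.

Lemma Vmon_addE e f : Vmon_add (\pi_Vmon e) (\pi_Vmon f) = \pi_Vmon (idem_add e f).
Proof.
by apply/eqP/Vmon_eqP/idem_add_iso; apply/Vmon_eqP; rewrite reprK.
Qed.

Lemma Vmon_ind (Q : Vmon -> Prop) : (forall e, Q (\pi_Vmon e)) -> forall x, Q x.
Proof. by move=> h x; rewrite -[x]reprK. Qed.

Lemma Vmon_addA : associative Vmon_add.
Proof.
elim/Vmon_ind => e; elim/Vmon_ind => f; elim/Vmon_ind => g.
rewrite !Vmon_addE; apply/eqP/Vmon_eqP.
apply: mod_iso_trans (idem_mod_add _ _) _.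
apply: mod_iso_trans (mod_iso_prod (mod_iso_refl _) (idem_mod_add _ _)) _.
apply: mod_iso_trans (mod_iso_prodA _ _ _) _.
apply: mod_iso_sym.
apply: mod_iso_trans (idem_mod_add _ _) _.
exact: mod_iso_prod (idem_mod_add _ _) (mod_iso_refl _).
Qed.

Lemma Vmon_addC : commutative Vmon_add.
Proof.
elim/Vmon_ind => e; elim/Vmon_ind => f.
rewrite !Vmon_addE; apply/eqP/Vmon_eqP.
apply: mod_iso_trans (idem_mod_add _ _) _.
apply: mod_iso_trans (mod_iso_prodC _ _) _.
exact/mod_iso_sym/idem_mod_add.
Qed.

Lemma Vmon_add0 : left_id (\pi_Vmon idem0) Vmon_add.
Proof.
elim/Vmon_ind => e; rewrite Vmon_addE; apply/eqP/Vmon_eqP.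
exact: mod_iso_trans (idem_mod_add _ _) (idem_mod_add0 _).
Qed.

HB.instance Definition _ :=
  GRing.isNmodule.Build Vmon Vmon_addA Vmon_addC Vmon_add0.

Definition K0 := groth Vmon.
HB.instance Definition _ := GRing.Zmodule.on K0.

Definition Vclass (M : lmodType B) (hM : mod_fgp M) : Vmon :=
  \pi_Vmon (sval (cid (fgp_code hM))).

Definition K0class (M : lmodType B) (hM : mod_fgp M) : K0 :=
  groth_of (Vclass hM).

Lemma VclassE (M : lmodType B) (hM : mod_fgp M) (e : idem) :
  mod_iso M (idem_mod e) -> Vclass hM = \pi_Vmon e.
Proof.
move=> h; apply/eqP/Vmon_eqP; case: cid => f /= k.
exact: mod_iso_trans (mod_iso_sym k) h.
Qed.

End Modules.

Definition is_ring_structure (G : zmodType) (mul : G -> G -> G) (one : G) :=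
  [/\ associative mul, left_id one mul, right_id one mul,
      left_distributive mul +%R & right_distributive mul +%R].

(* Nonzero unital C*-algebras over [R[i]]: a Banach space with a product, a
   unit and an involution. The norm takes values in the nonnegative reals of
   [R[i]]. This is a plain record because the library has no structure joining
   rings and normed modules. *)
Record cstarAlg (R : realType) := CStarAlg {
  cs_space : completeNormedModType R[i];
  cs_mul : cs_space -> cs_space -> cs_space;
  cs_one : cs_space;
  cs_star : cs_space -> cs_space;
  cs_mulA : associative cs_mul;
  cs_mul1l : left_id cs_one cs_mul;
  cs_mul1r : right_id cs_one cs_mul;
  cs_mulDl : left_distributive cs_mul +%R;
  cs_mulDr : right_distributive cs_mul +%R;
  cs_mulZl : forall (a : R[i]) x y, a *: cs_mul x y = cs_mul (a *: x) y;
  cs_mulZr : forall (a : R[i]) x y, a *: cs_mul x y = cs_mul x (a *: y);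
  cs_one_neq0 : cs_one != 0;
  cs_starK : involutive cs_star;
  cs_starD : {morph cs_star : x y / x + y};
  cs_starZ : forall (a : R[i]) x, cs_star (a *: x) = a^* *: cs_star x;
  cs_starM : forall x y, cs_star (cs_mul x y) = cs_mul (cs_star y) (cs_star x);
  cs_normM : forall x y, `|cs_mul x y| <= `|x| * `|y|;
  cs_normS : forall x, `|cs_mul (cs_star x) x| = `|x| ^+ 2 }.

Definition cs_sort (R : realType) (A : cstarAlg R) : Type := cs_space A.
Coercion cs_sort : cstarAlg >-> Sortclass.

Section CStarInstances.
Variables (R : realType) (A : cstarAlg R).

HB.instance Definition _ := CompleteNormedModule.copy (cs_sort A) (cs_space A).
HB.instance Definition _ := GRing.Zmodule_isNzRing.Build (cs_sort A)
  (@cs_mulA R A) (@cs_mul1l R A) (@cs_mul1r R A) (@cs_mulDl R A)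
  (@cs_mulDr R A) (@cs_one_neq0 R A).
HB.instance Definition _ := GRing.Lmodule_isLalgebra.Build R[i] (cs_sort A)
  (@cs_mulZl R A).
HB.instance Definition _ := GRing.Lalgebra_isAlgebra.Build R[i] (cs_sort A)
  (@cs_mulZr R A).

Definition star : A -> A := @cs_star R A.

Lemma starK : involutive star. Proof. exact: cs_starK. Qed.
Lemma starD : {morph star : x y / x + y}. Proof. exact: cs_starD. Qed.
Lemma starZ (a : R[i]) x : star (a *: x) = a^* *: star x.
Proof. exact: cs_starZ. Qed.
Lemma starM x y : star (x * y) = star y * star x. Proof. exact: cs_starM. Qed.
Lemma cstar_normM (x y : A) : `|x * y| <= `|x| * `|y|.
Proof. exact: cs_normM. Qed.
Lemma cstar_normS (x : A) : `|star x * x| = `|x| ^+ 2.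
Proof. exact: cs_normS. Qed.

End CStarInstances.

(* *-homomorphisms are not required to preserve the unit. *)
Definition star_hom (R : realType) (A D : cstarAlg R) (phi : A -> D) :=
  [/\ linear phi,
      {morph phi : x y / x * y} &
      {morph phi : x / star x}].

Definition closed_star_subalg (R : realType) (A : cstarAlg R) (X : set A) :=
  [/\ closed X,
      X 0,
      forall (a : R[i]) x y, X x -> X y -> X (a *: x + y),
      forall x y, X x -> X y -> X (x * y) &
      forall x, X x -> X (star x)].

(* The edge [e_ij : v_i -> v_j] is the pair [(i, j)]. *)
Definition edge (n : nat) : finType :=
  {ij : 'I_n.+1 * 'I_n.+1 | (ij.1 <= ij.2)%N}.
Definition esrc n (e : edge n) : 'I_n.+1 := (val e).1.
Definition etgt n (e : edge n) : 'I_n.+1 := (val e).2.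

Record ck_family (R : realType) (n : nat) (A : cstarAlg R)
    (P : 'I_n.+1 -> A) (S : edge n -> A) : Prop := {
  ck_proj : forall v, P v * P v = P v /\ star (P v) = P v;
  ck_orth : forall v w, v != w -> P v * P w = 0;
  ck_pisom : forall e, S e * star (S e) * S e = S e;
  ck_tgt : forall e, star (S e) * S e = P (etgt e);
  ck_src : forall v, \sum_(e | esrc e == v) S e * star (S e) = P v }.

(* [A] is the universal C*-algebra generated by the Cuntz-Krieger family
   [(P, S)]. Uniqueness of the *-homomorphism of [univ_hom] follows from
   [univ_gen]. *)
Record ck_universal (R : realType) (n : nat) (A : cstarAlg R)
    (P : 'I_n.+1 -> A) (S : edge n -> A) : Prop := {
  univ_ck : ck_family P S;
  univ_gen : forall X : set A, closed_star_subalg X ->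
    (forall v, X (P v)) -> (forall e, X (S e)) -> forall a, X a;
  univ_hom : forall (D : cstarAlg R) (Q : 'I_n.+1 -> D) (T : edge n -> D),
    ck_family Q T ->
    exists phi : A -> D,
      [/\ star_hom phi, forall v, phi (P v) = Q v & forall e, phi (S e) = T e] }.

(* The gauge action is determined by its values on the generators; only the
   [gauge z] with [`|z| = 1] matter. *)
Record gauge_action (R : realType) (n : nat) (A : cstarAlg R)
    (P : 'I_n.+1 -> A) (S : edge n -> A) (gamma : R[i] -> A -> A) : Prop := {
  gauge_hom : forall z, `|z| = 1 -> star_hom (gamma z);
  gauge_id : forall a, gamma 1 a = a;
  gauge_comp : forall z w, `|z| = 1 -> `|w| = 1 ->
    forall a, gamma (z * w) a = gamma z (gamma w a);
  gauge_vproj : forall z, `|z| = 1 -> forall v, gamma z (P v) = P v;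
  gauge_eisom : forall z, `|z| = 1 -> forall e, gamma z (S e) = z *: S e }.

(* The C*-algebra [C(S_q^{2n+1})] with its generators and its gauge action: it
   is determined up to equivariant *-isomorphism. *)
Record quantum_sphere (R : realType) (n : nat) := QuantumSphere {
  qs_alg :> cstarAlg R;
  vproj : 'I_n.+1 -> qs_alg;
  eisom : edge n -> qs_alg;
  gauge : R[i] -> qs_alg -> qs_alg;
  qs_univ : ck_universal vproj eisom;
  qs_gauge : gauge_action vproj eisom gauge }.

Section ProjectiveSpace.
Variables (R : realType) (n : nat) (A : quantum_sphere R n).
Implicit Types (z : R[i]) (a b : A) (k : int).

Lemma gauge_lin z : `|z| = 1 -> linear (@gauge R n A z).
Proof. by move=> /(gauge_hom (qs_gauge A))[]. Qed.

Lemma gauge0 z : `|z| = 1 -> gauge z (0 : A) = 0.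
Proof.
by move=> /gauge_lin l; have := l (-1) 0 0; rewrite !scaleN1r !addNr.
Qed.

Lemma gaugeB z a b : `|z| = 1 -> gauge z (a - b) = gauge z a - gauge z b.
Proof.
by move=> /gauge_lin l; rewrite addrC -scaleN1r l scaleN1r addrC.
Qed.

Lemma gaugeM z a b : `|z| = 1 -> gauge z (a * b) = gauge z a * gauge z b.
Proof. by move=> /(gauge_hom (qs_gauge A))[_ m _]; rewrite m. Qed.

Lemma gauge1 z : `|z| = 1 -> gauge z (1 : A) = 1.
Proof.
move=> z1; have zV1 : `|z^-1| = 1 by rewrite normfV z1 invr1.
have z0 : z != 0 by rewrite -normr_eq0 z1 oner_eq0.
have gK a : gauge z (gauge z^-1 a) = a.
  by rewrite -(gauge_comp (qs_gauge A)) // divff // (gauge_id (qs_gauge A)).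
by rewrite -[LHS]mulr1 -[X in _ * X]gK -gaugeM // mul1r gK.
Qed.

(* [C(CP_q^n)], the fixed-point algebra of the gauge action. *)
Definition cp_pred : {pred A} :=
  fun a => `[< forall z, `|z| = 1 -> gauge z a = a >].

Lemma cp_predP a :
  reflect (forall z, `|z| = 1 -> gauge z a = a) (a \in cp_pred).
Proof. exact: asboolP. Qed.

Lemma cp_pred_closed : subring_closed cp_pred.
Proof.
split.
- by apply/cp_predP => z; exact: gauge1.
- by move=> a b /cp_predP ha /cp_predP hb; apply/cp_predP => z z1;
    rewrite gaugeB // ha // hb.
- by move=> a b /cp_predP ha /cp_predP hb; apply/cp_predP => z z1;
    rewrite gaugeM // ha // hb.
Qed.
HB.instance Definition _ :=
  GRing.isSubringClosed.Build A cp_pred cp_pred_closed.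

Record cp_alg := CPAlg { cp_val : A; cp_valP : cp_val \in cp_pred }.
HB.instance Definition _ := [isSub for cp_val].
HB.instance Definition _ := [Choice of cp_alg by <:].
HB.instance Definition _ := [SubChoice_isSubNzRing of cp_alg by <:].

(* The spectral subspaces [L_k]. *)
Definition L_pred k : {pred A} :=
  fun a => `[< forall z, `|z| = 1 -> gauge z a = (z ^ k) *: a >].

Lemma L_predP k a :
  reflect (forall z, `|z| = 1 -> gauge z a = (z ^ k) *: a) (a \in L_pred k).
Proof. exact: asboolP. Qed.

Lemma L_pred_closed k : zmod_closed (L_pred k).
Proof.
split; first by apply/L_predP => z z1; rewrite gauge0 // scaler0.
move=> a b /L_predP ha /L_predP hb; apply/L_predP => z z1.
by rewrite gaugeB // ha // hb // scalerBr.
Qed.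
HB.instance Definition _ k :=
  GRing.isZmodClosed.Build A (L_pred k) (L_pred_closed k).

Record line_mod k := LineMod { line_val : A; line_valP : line_val \in L_pred k }.
HB.instance Definition _ k := [isSub for @line_val k].
HB.instance Definition _ k := [Choice of line_mod k by <:].
HB.instance Definition _ k := [SubChoice_isSubZmodule of line_mod k by <:].

Lemma line_scaleP k (b : cp_alg) (a : line_mod k) :
  cp_val b * line_val a \in L_pred k.
Proof.
apply/L_predP => z z1; rewrite gaugeM // (cp_predP _ (cp_valP b)) //.
by rewrite (L_predP _ _ (line_valP a)) // scalerAr.
Qed.

Definition line_scale k (b : cp_alg) (a : line_mod k) : line_mod k :=
  LineMod (line_scaleP b a).

Lemma line_scaleA k (b c : cp_alg) (a : line_mod k) :
  line_scale b (line_scale c a) = line_scale (b * c) a.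
Proof. by apply: val_inj; rewrite /= mulrA. Qed.

Lemma line_scale1 k : left_id 1 (@line_scale k).
Proof. by move=> a; apply: val_inj; rewrite /= mul1r. Qed.

Lemma line_scaleDr k : right_distributive (@line_scale k) +%R.
Proof. by move=> b a a'; apply: val_inj; rewrite /= mulrDr. Qed.

Lemma line_scaleDl k (a : line_mod k) :
  {morph (@line_scale k)^~ a : b c / b + c}.
Proof. by move=> b c; apply: val_inj; rewrite /= mulrDl. Qed.

HB.instance Definition _ k := GRing.Zmodule_isLmodule.Build cp_alg (line_mod k)
  (@line_scaleA k) (@line_scale1 k) (@line_scaleDr k) (@line_scaleDl k).

End ProjectiveSpace.

(* Main.v *)
Require Import Defs.
From HB Require Import structures.
From mathcomp Require Import all_boot all_order all_algebra.
From mathcomp Require Import generic_quotient complex.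
From mathcomp Require Import all_classical all_reals all_analysis.
From mathcomp Require Import zify ring lra.
From Stdlib Require Ncring Ncring_tac.
Set Implicit Arguments.
Unset Strict Implicit.
Unset Printing Implicit Defensive.
Import Order.TTheory GRing.Theory Num.Theory.
Import numFieldNormedType.Exports.
Local Open Scope classical_set_scope.
Local Open Scope quotient_scope.
Local Open Scope ring_scope.

(** The group [K0] of [B := cp_alg A] is cyclic as a module over [Z[s]], where
    [s] is an additive operator with [s [L_k] = [L_(k+1)]]; it is therefore a
    quotient of [Z[s]] by an ideal, hence a ring, and in this ring
    [[L_j][L_k] = s^j s^k [L_0] = [L_(j+k)]]. This is [cyclic_ring].

    The operator [s] comes from an isometry. The sum [U] of the loops satisfies
    [U^* U = 1] and has degree one for the gauge action, so [b |-> U b U^*] is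
    an endomorphism of [B], and it sends an idempotent matrix to one that is
    equivalent to it through matrices of degree one. Equivalence of idempotents
    [e = u v], [f = v u] with [u] of degree [d] and [v] of degree [-d]
    ([gequiv]) is the main bookkeeping device. In degree zero it is isomorphism
    of modules over [B] ([gequiv0_iso]); the module [L_k] is the one of any
    idempotent equivalent to [1] in degree [k] ([line_iso]), and such idempotents
    exist ([line_code]), which also shows that [L_k] is finitely generated and
    projective. Degrees add up under composition, so [s [L_k] = [L_(k+1)]].

    It remains to see that a subgroup [H] that contains [[L_0]] and is stable
    under [s] is everything ([K0_generated]). Put [Q_i = sum_(j >= i) P_j]. The
    edges leaving [v_i] give an equivalence of degree one between [P_i] and
    [Q_i], so [[P_i] = s [Q_i]] and [[Q_(i+1)] = [Q_i] - s [Q_i]]; as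
    [[Q_0] = [L_0]], every [[P_i]] lies in [H]. Further, [B] is the closure of
    the increasing union of the spans of the [S_mu S_nu^*] with [mu], [nu] of
    the same length [k] ([core_dense]), so an idempotent matrix [e] over [B] is
    equivalent to one with entries in such a span ([banach_idem_approx]).
    Conjugating with the edges lowers [k] at the price of one application of [s],
    and for [k = 0] the entries are combinations of the [P_i], so that
    the idempotent is a family of complex idempotent matrices, which are
    classified by their ranks ([inH_complex]).

    The analysis behind this is elementary and rests on one contraction argument,
    which provides inverses, square roots and the correction of almost idempotent
    elements. Two facts that are usually deduced from spectral theory come from
    the square root alone: for commuting self-adjoint [h], [k] with
    [h ^ 2 + k ^ 2 = c], the element [h + i k] shows [||h|| ^ 2 <= c]
    ([cstar_cos]). Hence the gauge automorphisms are contractive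
    ([star_hom_contractive]), and projections that add up to a projection are
    orthogonal ([proj_sum_orth]). *)

(** * Fixed points in complete normed rings *)

Lemma cauchy_seq_lim (K : numFieldType) (V : completeNormedModType K)
    (u : nat -> V) :
  (forall e : K, 0 < e -> exists n0, forall n, (n0 <= n)%N -> `|u n - u n0| < e) ->
  exists l, forall e : K, 0 < e ->
    exists n0, forall n, (n0 <= n)%N -> `|l - u n| < e.
Proof.
move=> hu.
have /cauchy_exP/cauchy_cvgP/cvg_ex[l hl] : cauchy_ex (u @ \oo).
  move=> e e0; have [n0 h] := hu e e0; exists (u n0).
  by exists n0 => // n /h; rewrite -ball_normE /ball_ /= distrC.
exists l => e e0; move/cvgrPdist_lt: hl => /(_ e e0) [n0 _ h].
by exists n0.
Qed.

Section Banach.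
Variable R : realType.

(** Norm and completeness form one predicate, so that the same arguments apply
    to a C*-algebra and to the square matrices over it. *)
Record banach_norm (V : pzRingType) (N : V -> R) : Prop := {
  bn0 : N 0 = 0;
  bn_eq0 : forall x, N x = 0 -> x = 0;
  bnN : forall x, N (- x) = N x;
  bnD : forall x y, N (x + y) <= N x + N y;
  bnM : forall x y, N (x * y) <= N x * N y;
  bn_complete : forall (u : nat -> V),
    (forall e, 0 < e -> exists n0, forall n, (n0 <= n)%N -> N (u n - u n0) < e) ->
    exists l, forall e, 0 < e -> exists n0, forall n, (n0 <= n)%N -> N (l - u n) < e }.

Section Theory.
Variables (V : pzRingType) (N : V -> R).
Hypothesis hN : banach_norm N.

Definition norm_closed (U : V -> Prop) :=
  forall t, (forall e, 0 < e -> exists2 u, U u & N (t - u) < e) -> U t.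

Lemma bn_ge0 x : 0 <= N x.
Proof.
have := bnD hN x (- x); rewrite subrr (bn0 hN) (bnN hN) => h; lra.
Qed.

Lemma bnB x y : N (x - y) <= N x + N y.
Proof. by rewrite -[N y](bnN hN) (bnD hN). Qed.

Lemma bnC x y : N (x - y) = N (y - x).
Proof. by rewrite -opprB (bnN hN). Qed.

Lemma bn_tri y x z : N (x - z) <= N (x - y) + N (y - z).
Proof. by apply: le_trans (bnD hN _ _); rewrite addrA subrK. Qed.

Lemma bn_le0 x : (forall e, 0 < e -> N x <= e) -> x = 0.
Proof.
move=> h; apply: (bn_eq0 hN); apply/eqP; rewrite eq_le bn_ge0 andbT.
by apply/ler_addgt0Pr => e /h; rewrite add0r.
Qed.

Lemma geometric_cauchy (u : nat -> V) (C r : R) : 0 <= r < 1 ->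
  (forall n, N (u n.+1 - u n) <= C * r ^+ n) ->
  forall e, 0 < e -> exists n0, forall n, (n0 <= n)%N -> N (u n - u n0) < e.
Proof.
move=> /andP[r0 r1] hu e e0.
have C0 : 0 <= C by have := le_trans (bn_ge0 _) (hu 0%N); rewrite expr0 mulr1.
have tail n0 k : N (u (n0 + k)%N - u n0) <= C * r ^+ n0 * (1 - r ^+ k) / (1 - r).
  elim: k => [|k IH]; first by rewrite addn0 subrr (bn0 hN) expr0 subrr mulr0 mul0r.
  apply: le_trans (bn_tri (u (n0 + k)%N) _ _) _.
  rewrite addnS; apply: le_trans (lerD (hu _) IH) _.
  rewrite le_eqVlt; apply/orP; left; apply/eqP.
  by rewrite exprD exprS; field; lra.
have hpos : 0 < e * (1 - r) / (C + 1) by rewrite divr_gt0 ?mulr_gt0 //; lra.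
have /cvgrPdist_lt /(_ _ hpos) [n0 _ hn0] : (fun n => r ^+ n) @ \oo --> (0 : R).
  by apply: cvg_expr; rewrite ger0_norm.
exists n0 => n le_n; have := tail n0 (n - n0)%N; rewrite subnKC // => ht.
apply: le_lt_trans ht _.
have := hn0 n0 (leqnn _); rewrite /= sub0r normrN ger0_norm ?exprn_ge0 // => h.
rewrite ltr_pdivrMr ?subr_gt0 //.
have h1 : C * r ^+ n0 * (1 - r ^+ (n - n0)) <= C * r ^+ n0.
  rewrite ler_piMr ?mulr_ge0 ?exprn_ge0 //.
  by rewrite lerBlDr lerDl exprn_ge0.
apply: le_lt_trans h1 _.
move: h; rewrite ltr_pdivlMr; last lra.
have := exprn_ge0 n0 r0; nra.
Qed.

(** Membership in [U] is part of the conclusion: the fixed point inherits every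
    property that [T] and limits preserve. This is how commutation relations and
    membership in subalgebras are obtained for inverses, square roots and
    idempotents. *)
Lemma banach_fixpoint (U : V -> Prop) (T : V -> V) (k : R) :
  0 <= k < 1 -> norm_closed U -> U 0 -> (forall t, U t -> U (T t)) ->
  (forall t s, U t -> U s -> N (T t - T s) <= k * N (t - s)) ->
  exists2 t, U t & T t = t.
Proof.
move=> k01 clU U0 UT hT; pose u n := iter n T 0.
have Uu n : U (u n) by elim: n => //= n; apply: UT.
have hu n : N (u n.+1 - u n) <= N (u 1%N - u 0%N) * k ^+ n.
  elim: n => [|n IH]; first by rewrite mulr1.
  have h := hT _ _ (Uu n.+1) (Uu n); apply: le_trans h _.
  rewrite exprS mulrCA; apply: ler_wpM2l IH; by case/andP: k01.
have [l hl] := bn_complete hN (geometric_cauchy k01 hu).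
have Ul : U l.
  by apply: clU => e /hl[n h]; exists (u n) => //; apply: h.
exists l => //; apply/eqP; rewrite -subr_eq0; apply/eqP/bn_le0 => e e0.
have [n h] := hl (e / 2) ltac:(lra).
apply: le_trans (bn_tri (u n.+1) _ _) _.
have h1 := hT _ _ Ul (Uu n).
have h2 := h n (leqnn _); have h3 := h n.+1 (leqnSn _).
have h4 : N (T l - u n.+1) <= N (l - u n).
  apply: le_trans h1 _; rewrite ler_piMl ?bn_ge0 //; case/andP: k01; lra.
rewrite (bnC _ l); lra.
Qed.

Lemma norm_closedI (U W : V -> Prop) :
  norm_closed U -> norm_closed W -> norm_closed (fun t => U t /\ W t).
Proof.
by move=> hU hW t h; split; [apply: hU | apply: hW] => e /h[u [? ?] ?]; exists u.
Qed.

Lemma norm_closed_lip (W : pzRingType) (M : W -> R) (f : W -> V) (K : R)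
    (U : V -> Prop) : 0 <= K ->
  (forall x y, N (f x - f y) <= K * M (x - y)) -> norm_closed U ->
  forall t, (forall e, 0 < e -> exists2 u, U (f u) & M (t - u) < e) -> U (f t).
Proof.
move=> K0 hf hU t ht; apply: hU => e e0.
have [|u Uu hu] := ht (e / (K + 1)); first by rewrite divr_gt0 //; lra.
exists (f u) => //; apply: le_lt_trans (hf _ _) _.
by move: hu; rewrite ltr_pdivlMr; [nra | lra].
Qed.

Lemma norm_closed0 : norm_closed (fun t => t = 0).
Proof.
move=> t h; apply: bn_le0 => e /h[u ->]; rewrite subr0; exact: ltW.
Qed.

Lemma norm_closed_ball r : norm_closed (fun t => N t <= r).
Proof.
move=> t h; apply/ler_addgt0Pr => e /h[u hu he].
have := bn_tri u t 0; rewrite !subr0; lra.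
Qed.

Lemma norm_closed_eq (f g : V -> V) (K : R) : 0 <= K ->
  (forall x y, N ((f x - g x) - (f y - g y)) <= K * N (x - y)) ->
  norm_closed (fun t => f t = g t).
Proof.
move=> K0 hfg t ht; apply/eqP; rewrite -subr_eq0; apply/eqP.
apply: (norm_closed_lip (f := fun x => f x - g x) K0 hfg norm_closed0) => e /ht[u fg hu].
by exists u => //; rewrite fg subrr.
Qed.

Lemma norm_closed_comm y : norm_closed (fun t => t * y = y * t).
Proof.
apply: (norm_closed_eq (K := 2 * N y)) => [|x z]; first by rewrite mulr_ge0 ?bn_ge0.
have -> : x * y - y * x - (z * y - y * z) = (x - z) * y - y * (x - z).
  by rewrite mulrBl mulrBr !opprB addrACA [RHS]addrACA [- (z * y) - _]addrC.
by apply: le_trans (bnB _ _) _; have := bnM hN (x - z) y; have := bnM hN y (x - z); lra.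
Qed.

(** The inverse of [1 + y] is the fixed point of [t |-> 1 - y t]; it is
    two-sided because this map preserves commutation with [y]. *)
Lemma banach_inverse (U : V -> Prop) (y : V) :
  N y < 1 -> norm_closed U -> U 0 -> (forall t, U t -> U (1 - y * t)) ->
  exists t, [/\ U t, (1 + y) * t = 1 & t * (1 + y) = 1].
Proof.
move=> y1 clU U0 UT.
have [s [sy Us] e] : exists2 s, s * y = y * s /\ U s & 1 - y * s = s.
  apply: (banach_fixpoint (k := N y)).
  - by rewrite bn_ge0.
  - by apply: (@norm_closedI (fun s => s * y = y * s) U) => //; exact: norm_closed_comm.
  - by rewrite mul0r mulr0.
  - move=> t [ty Ut]; split; last exact: UT.
    by rewrite mulrBl mulrBr mul1r mulr1 -!mulrA ty.
  - move=> t s _ _; rewrite opprB addrC addrA subrK -mulrBr (bnC t).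
    exact: (bnM hN).
exists s; split=> //.
  by rewrite mulrDl mul1r -{1}e subrK.
by rewrite mulrDr mulr1 sy -{1}e subrK.
Qed.

End Theory.
End Banach.

(** * Idempotents in complete normed rings *)

(** These instances let [ncring] decide identities in noncommutative rings by
    normalisation. *)
#[local] Instance pzRing_ops (V : pzRingType) :
  @Ncring.Ring_ops V 0 1 +%R *%R (fun x y => x - y) -%R eq := {}.
#[local] Instance pzRing_ncring (V : pzRingType) :
  @Ncring.Ring V 0 1 +%R *%R (fun x y => x - y) -%R eq (pzRing_ops V).
Proof.
constructor; try exact _; do ?[by move=> x y -> z t -> | by move=> x y ->].
- exact: add0r.
- exact: addrC.
- exact: addrA.
- exact: mul1r.
- exact: mulr1.
- exact: mulrA.
- exact: mulrDl.
- by move=> x y z; apply: mulrDr.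
- by [].
- exact: subrr.
Qed.

Ltac ncring := Ncring_tac.non_commutative_ring.

Section Refine.
Variables (R : realType) (V : pzRingType) (N : V -> R).
Hypothesis hN : banach_norm N.

Definition rng_closed (U : V -> Prop) :=
  [/\ U 0, forall x y, U x -> U y -> U (x - y) &
      forall x y, U x -> U y -> U (x * y)].

Lemma rng_closedD U x y : rng_closed U -> U x -> U y -> U (x + y).
Proof. by case=> U0 UB _ Ux Uy; rewrite -[y]opprK -[- y]sub0r; apply/UB/UB. Qed.

Lemma banach_sqr_lip r t s : N t <= r -> N s <= r ->
  N (t * t - s * s) <= 2 * r * N (t - s).
Proof.
move=> ht hs; have -> : t * t - s * s = t * (t - s) + (t - s) * s by ncring.
apply: le_trans (bnD hN _ _) _.
have := bnM hN t (t - s); have := bnM hN (t - s) s.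
have := bn_ge0 hN (t - s); nra.
Qed.

(** The solution [w] of [w = x + w ^ 2] is the Catalan series of [x], so that
    [1 - 2 w] is the square root of [1 - 4 x]. *)
Lemma banach_sqrt (U : V -> Prop) (x : V) (s : R) :
  0 <= s < 1 -> 4 * N x <= s -> norm_closed N U -> U 0 ->
  (forall t, U t -> U (x + t * t)) -> exists2 w, U w & x + w * w = w.
Proof.
move=> /andP[s0 s1] hx clU U0 UT.
have [w [Uw _] e] : exists2 w, U w /\ N w <= s / 2 & x + w * w = w.
  apply: (banach_fixpoint hN (k := s)).
  - by rewrite s0.
  - by apply: (@norm_closedI _ _ N U (fun w => N w <= s / 2)) => //;
      exact: norm_closed_ball.
  - by split=> //; rewrite (bn0 hN); lra.
  - move=> t [Ut ht]; split; first exact: UT.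
    apply: le_trans (bnD hN _ _) _; have := bnM hN t t; have := bn_ge0 hN t; nra.
  - move=> t u [_ ht] [_ hu]; rewrite opprD addrACA subrr add0r.
    by apply: le_trans (banach_sqr_lip ht hu) _;
      rewrite mulrC [2 * _]mulrC divfK ?pnatr_eq0 // mulrC.
by exists w.
Qed.

(** Newton refinement in closed form: with [x = a - a ^ 2] and [b = 1 - 2 a],
    the element [f = a + b t] satisfies
    [f ^ 2 - f = (1 - 4 x) (t ^ 2 - t) - x], and the vanishing of the right
    hand side is a fixed point equation for a small [t]. *)
Lemma banach_idem (U : V -> Prop) (a : V) (r : R) :
  0 < r -> r <= 1 / 8 -> 32 * N (a - a * a) <= r ->
  rng_closed U -> norm_closed N U -> U a ->
  exists f, [/\ U f, f * f = f & N (f - a) <= r * (1 + 2 * N a)].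
Proof.
move=> r0 r8 hx sU clU Ua; set x := a - a * a in hx.
have [U0 UB UM] := sU.
have UD t s : U t -> U s -> U (t + s) by exact: rng_closedD.
have Ux : U x by apply: (UB) => //; apply: (UM).
have ax : GRing.comm a x by rewrite /GRing.comm /x; ncring.
have x0 := bn_ge0 hN x.
have N4 y : N (y + y + y + y) <= 4 * N y.
  have := bnD hN (y + y + y) y; have := bnD hN (y + y) y; have := bnD hN y y; lra.
pose q t := x * (t * t - t).
have [t [[Ut ta] ht] e] : exists2 t, ((U t /\ t * a = a * t) /\ N t <= r) &
    t * t - x - (q t + q t + q t + q t) = t.
  (* For [N x <= r / 32] and [r <= 1 / 8] the ball of radius [r] is mapped to
     itself with ratio [1 / 2]. *)
  apply: (banach_fixpoint hN (k := 1 / 2)).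
  - by lra.
  - apply: (@norm_closedI _ _ N (fun t => U t /\ t * a = a * t)).
      by apply: (@norm_closedI _ _ N U (fun t => t * a = a * t)) => //;
        exact: norm_closed_comm.
    exact: norm_closed_ball.
  - by rewrite (bn0 hN) mul0r mulr0; split; [split|lra].
  - move=> t [[Ut ta] ht]; split; first split.
    + have Uq : U (q t) by apply: (UM) => //; apply: (UB) => //; apply: (UM).
      by apply: (UB); [apply: (UB) => //; apply: (UM) | do 3!(apply: (UD) => //)].
    + have at' : GRing.comm a t by rewrite /GRing.comm ta.
      have aq : GRing.comm a (q t).
        by apply: commrM => //; apply: commrB => //; apply: commrM.
      apply/esym; apply: commrB; first by apply: commrB => //; apply: commrM.
      by do 3!(apply: commrD => //).
    + have h1 := bnM hN t t; have t0 := bn_ge0 hN t.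
      have h2 := N4 (q t); have h3 : N (q t) <= _ := bnM hN x (t * t - t).
      have h4 := bnB hN (t * t) t.
      apply: le_trans (bnB hN _ _) _; have := bnB hN (t * t) x.
      have h5 : N (t * t) <= r * r by nra.
      have h6 : N x * N (t * t - t) <= N x * (r * r + r) by nra.
      nra.
  - move=> t s [_ ht] [_ hs].
    have h1 := banach_sqr_lip ht hs; set d := N (t - s) in h1 *.
    have d0 : 0 <= d by exact: bn_ge0.
    pose p := x * ((t * t - s * s) - (t - s)).
    have -> : t * t - x - (q t + q t + q t + q t)
        - (s * s - x - (q s + q s + q s + q s))
      = (t * t - s * s) - (p + p + p + p) by rewrite /p /q; ncring.
    have h2 := N4 p.
    have h3 : N p <= _ := bnM hN x ((t * t - s * s) - (t - s)).
    have h4 := bnB hN (t * t - s * s) (t - s).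
    apply: le_trans (bnB hN _ _) _; rewrite -/d in h4.
    have h6 : N x * N (t * t - s * s - (t - s)) <= N x * (2 * r * d + d) by nra.
    have h7 : r * d <= d / 8 by nra.
    have h8 : N x * (2 * r * d + d) <= 1 / 256 * (2 * r * d + d) by nra.
    lra.
pose b := 1 - a - a; pose f := a + b * t.
have tb : t * b = b * t.
  have -> : t * b = t - t * a - t * a by rewrite /b; ncring.
  by rewrite ta /b; ncring.
have eq_f : f * f - f = t * t - x - (q t + q t + q t + q t) - t.
  have -> : f * f = a * a + a * b * t + b * (t * a) + b * (t * b) * t.
    by rewrite /f; ncring.
  by rewrite tb ta /f /b /q /x; ncring.
exists f; split.
- have -> : f = a + t - a * t - a * t by rewrite /f /b; ncring.
  have Uat : U (a * t) by exact: UM.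
  by do 2!(apply: (UB) => //); apply: (UD).
- by apply/eqP; rewrite -subr_eq0 eq_f e subrr.
- have -> : f - a = t - a * t - a * t by rewrite /f /b; ncring.
  have := bnM hN a t; have := bnB hN (t - a * t) (a * t); have := bnB hN t (a * t).
  have a0 := bn_ge0 hN a; have t0 := bn_ge0 hN t; nra.
Qed.

(** Close idempotents are equivalent: [u = 1 + (2 e - 1) (f - e)] intertwines
    [e] and [f], and it is invertible when [f - e] is small. *)
Lemma banach_idem_equiv (U : V -> Prop) (e f : V) :
  e * e = e -> f * f = f -> rng_closed U -> U 1 -> norm_closed N U -> U e -> U f ->
  (1 + 2 * N e) * N (f - e) < 1 ->
  exists x y, [/\ U x, U y, x * y = e & y * x = f].
Proof.
move=> ee ff sU U1 clU Ue Uf hD; have [U0 UB UM] := sU.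
pose y := e * (f - e) + e * (f - e) - (f - e).
have Uy : U y.
  have Ud : U (f - e) by exact: UB.
  by apply: (UB) => //; apply: rng_closedD => //; apply: (UM).
have hy : N y < 1.
  apply: le_lt_trans hD; rewrite /y.
  have := bnB hN (e * (f - e) + e * (f - e)) (f - e).
  have := bnD hN (e * (f - e)) (e * (f - e)); have := bnM hN e (f - e); lra.
have [v [Uv uv vu]] := banach_inverse hN hy clU U0
  (fun t Ut => UB _ _ U1 (UM _ _ Uy Ut)).
pose u := 1 + y; rewrite -/u in uv vu.
have uE : u = 1 - e - f + (e * f + e * f).
  rewrite /u /y; have -> : e * (f - e) = e * f - e by rewrite mulrBr ee.
  by ncring.
have eu : e * u = e * f.
  rewrite uE; have -> : e * (1 - e - f + (e * f + e * f)) =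
    e - e * e - e * f + (e * e * f + e * e * f) by ncring.
  by rewrite ee; ncring.
have uf : u * f = e * f.
  rewrite uE; have -> : (1 - e - f + (e * f + e * f)) * f =
    f - e * f - f * f + (e * (f * f) + e * (f * f)) by ncring.
  by rewrite ff; ncring.
have Uu : U u by apply: rng_closedD.
exists (e * u), (v * e); split; try by apply: (UM).
  have -> : e * u * (v * e) = e * (u * v) * e by ncring.
  by rewrite uv mulr1.
have -> : v * e * (e * u) = v * (e * e * u) by ncring.
by rewrite ee eu -uf mulrA vu mul1r.
Qed.

(** A good approximation [a] of an idempotent [e] is almost idempotent;
    [banach_idem] corrects it inside [W], and the result is still close enough to
    [e] for [banach_idem_equiv]. The distance [d] depends on [e] alone, so that
    [W] can be chosen after it. *)
Lemma banach_idem_approx (U : V -> Prop) (e : V) :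
  e * e = e -> rng_closed U -> U 1 -> norm_closed N U -> U e ->
  exists2 d : R, 0 < d & forall (W : V -> Prop) a, rng_closed W -> norm_closed N W ->
    (forall x, W x -> U x) -> W a -> N (a - e) < d ->
    exists f x y, [/\ W f, f * f = f, U x /\ U y, x * y = e & y * x = f].
Proof.
move=> ee sU U1 clU Ue; pose K := 4 + 2 * N e.
have e0 := bn_ge0 hN e; have K4 : 4 <= K by rewrite /K; lra.
(* [r] makes [K * (r * K)] equal to [1 / 8], and [d] is negligible against [r]. *)
pose r := (8 * K * K)^-1; pose d := r / (32 * K).
have KK : 16 <= K * K by nra.
have r0 : 0 < r by rewrite invr_gt0; nra.
have rK : r * (K * K) = 1 / 8 by rewrite /r; field; apply/eqP; lra.
have r8 : r <= 1 / 128 by nra.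
have d0 : 0 < d by rewrite divr_gt0 //; lra.
have dK : d * K = r / 32 by rewrite /d; field; apply/eqP; lra.
have dr : d <= r / 128 by nra.
exists d => // W a sW clW WU Wa had.
have [] := @banach_idem W a r r0 _ _ sW clW Wa; [lra| |].
  pose c := a - e; have -> : a - a * a = c - (e * c + c * e + c * c).
    have -> : a = e + c by rewrite /c; ncring.
    have -> : (e + c) * (e + c) = e * e + e * c + c * e + c * c by ncring.
    by rewrite ee; ncring.
  rewrite -/c in had; have c0 := bn_ge0 hN c.
  have := bnB hN c (e * c + c * e + c * c).
  have := bnD hN (e * c + c * e) (c * c); have := bnD hN (e * c) (c * e).
  have := bnM hN e c; have := bnM hN c e; have := bnM hN c c.
  rewrite /K in dK K4; have : N c * N c <= d by nra.
  have : N c * N e <= d * N e by nra.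
  lra.
move=> f [Wf ff hf].
have ha : N a <= N e + d.
  have := bnD hN (a - e) e; rewrite subrK; lra.
have hfe : N (f - e) <= r * K + d.
  apply: le_trans (bn_tri hN a _ _) _.
  have : r * (1 + 2 * N a) <= r * K by rewrite /K; nra.
  lra.
have [||x [y [Ux Uy xy yx]]] := @banach_idem_equiv U e f ee ff sU U1 clU Ue.
- exact: WU.
- have fe0 := bn_ge0 hN (f - e).
  apply: (@le_lt_trans _ _ (K * (r * K + d))); last by nra.
  by rewrite ler_pM //; rewrite /K; lra.
by exists f, x, y.
Qed.

End Refine.

Section MatrixNorm.
Variables (R : realType) (V : pzRingType) (N : V -> R).
Hypothesis hN : banach_norm N.
Variable m : nat.
Implicit Types x y : 'M[V]_m.

(** The sum of the entries' norms, unlike their maximum, is submultiplicative. *)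
Definition mxN x : R := \sum_i \sum_j N (x i j).

Lemma mxN_entry x i j : N (x i j) <= mxN x.
Proof.
rewrite /mxN (bigD1 i) //= (bigD1 j) //= -addrA lerDl addr_ge0 //.
  by apply: sumr_ge0 => *; exact: bn_ge0.
by apply: sumr_ge0 => *; apply: sumr_ge0 => *; exact: bn_ge0.
Qed.

Lemma bn_sum (I : Type) (s : seq I) (P : pred I) (F : I -> V) :
  N (\sum_(i <- s | P i) F i) <= \sum_(i <- s | P i) N (F i).
Proof.
elim/big_ind2: _ => [|a b c d h k|//]; first by rewrite (bn0 hN).
by apply: le_trans (bnD hN _ _) (lerD h k).
Qed.

Lemma fin_eventually (I : finType) (P : I -> nat -> Prop) :
  (forall i, exists n0, forall n, (n0 <= n)%N -> P i n) ->
  exists n0, forall n, (n0 <= n)%N -> forall i, P i n.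
Proof.
move=> /choice[f hf]; exists (\max_i f i) => n hn i; apply: hf.
exact: leq_trans (leq_bigmax i) hn.
Qed.

Lemma mxN_small (e : R) : 0 < e ->
  exists2 d, 0 < d & forall x, (forall i j, N (x i j) < d) -> mxN x < e.
Proof.
move=> e0; have h : 0 < (m * m)%:R + 1 :> R by rewrite ltr_wpDl.
exists (e / ((m * m)%:R + 1)) => [|x hx]; first by rewrite divr_gt0.
apply: (@le_lt_trans _ _ (\sum_(i < m) \sum_(j < m) e / ((m * m)%:R + 1))).
  by apply: ler_sum => i _; apply: ler_sum => j _; apply: ltW.
rewrite !sumr_const !card_ord -mulrnA -[_ *+ (m * m)]mulr_natr -mulrA.
by rewrite gtr_pMr // mulrC ltr_pdivrMr // mul1r ltrDl.
Qed.

Lemma mxN_banach : banach_norm mxN.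
Proof.
split.
- by rewrite /mxN big1 // => i _; rewrite big1 // => j _; rewrite mxE (bn0 hN).
- move=> x hx; apply/matrixP => i j; rewrite mxE; apply: (bn_eq0 hN).
  by apply/eqP; rewrite eq_le bn_ge0 // andbT -hx mxN_entry.
- by move=> x; apply: eq_bigr => i _; apply: eq_bigr => j _; rewrite mxE (bnN hN).
- move=> x y; rewrite /mxN -big_split; apply: ler_sum => i _.
  by rewrite -big_split; apply: ler_sum => j _; rewrite mxE (bnD hN).
- move=> x y; rewrite [X in _ <= X * _]/mxN mulr_suml; apply: ler_sum => i _.
  apply: (@le_trans _ _ (\sum_j \sum_k N (x i k) * N (y k j))).
    apply: ler_sum => j _; rewrite mxE; apply: le_trans (bn_sum _ _ _) _.
    by apply: ler_sum => k _; exact: (bnM hN).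
  rewrite exchange_big mulr_suml; apply: ler_sum => k _.
  rewrite -mulr_sumr ler_wpM2l ?(bn_ge0 hN) //.
  rewrite /mxN [leRHS](bigD1 k) //= lerDl.
  by apply: sumr_ge0 => *; apply: sumr_ge0 => *; exact: bn_ge0.
move=> u hu.
have /choice[l hl] (ij : 'I_m * 'I_m) : exists l, forall e, 0 < e ->
    exists n0, forall n, (n0 <= n)%N -> N (l - u n ij.1 ij.2) < e.
  apply: (bn_complete hN) => e /hu[n0 h]; exists n0 => n /h; apply: le_lt_trans.
  by have := mxN_entry (u n - u n0) ij.1 ij.2; rewrite !mxE.
exists (\matrix_(i, j) l (i, j)) => e /mxN_small[d d0 hd].
have [n0 hn] := fin_eventually (fun ij => hl ij d d0).
by exists n0 => n /hn h; apply: hd => i j; rewrite !mxE; exact: (h (i, j)).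
Qed.

End MatrixNorm.

(** * Square roots, contractivity and orthogonality in C*-algebras *)

Section CStar.
Variable R : realType.

Section Norm.
Variable A : cstarAlg R.
Implicit Types (a b x y p : A) (c : R[i]).

(** The norm takes its values in the nonnegative reals of [R[i]]; the real part
    makes them available to real arithmetic. *)
Definition nrm a : R := complex.Re `|a|.

Lemma nrmE a : `|a| = (nrm a)%:C%C.
Proof. by rewrite /nrm RRe_real // normr_real. Qed.

Lemma nrm_ltC a (e : R) : (`|a| < e%:C%C) = (nrm a < e).
Proof. by rewrite nrmE ltcR. Qed.

Lemma nrm_banach : banach_norm nrm.
Proof.
split.
- by rewrite /nrm normr0.
- by move=> x h; apply/normr0_eq0; rewrite nrmE h.
- by move=> x; rewrite /nrm normrN.
- by move=> x y; rewrite -lecR rmorphD /= -!nrmE ler_normD.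
- by move=> x y; rewrite -lecR rmorphM /= -!nrmE cstar_normM.
move=> u hu.
have [|l hl] := @cauchy_seq_lim _ (cs_space A) u.
  move=> e e0; have e0' : e = (complex.Re e)%:C%C by rewrite RRe_real // gtr0_real.
  move: e0; rewrite e0' ltcR => /hu[n0 h]; exists n0 => n /h.
  by rewrite -nrm_ltC.
exists l => e e0; have [|n0 h] := hl e%:C%C; first by rewrite ltcR.
by exists n0 => n /h; rewrite -nrm_ltC.
Qed.

Lemma nrmZ c a : nrm (c *: a) = complex.Re `|c| * nrm a.
Proof.
by rewrite /nrm normrZ; case: `|c| `|a| (nrmE a) => [r s] _ -> /=;
  rewrite mulr0 subr0.
Qed.

Lemma nrmZr (r : R) a : nrm (r%:C%C *: a) = `|r| * nrm a.
Proof. by rewrite nrmZ normc_def /= expr0n addr0 sqrtr_sqr. Qed.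

Lemma nrm1Z c a : `|c| = 1 -> nrm (c *: a) = nrm a.
Proof. by rewrite nrmZ => ->; exact: mul1r. Qed.

Lemma nrm_starM a : nrm (star a * a) = nrm a ^+ 2.
Proof. by apply: complexI; rewrite rmorphXn /= -!nrmE cstar_normS. Qed.

Let n0 := bn_ge0 nrm_banach.

Lemma star0 : star (0 : A) = 0.
Proof.
by have := starD (0 : A) 0; rewrite addr0 => /eqP;
  rewrite -subr_eq subrr eq_sym => /eqP.
Qed.

Lemma starN x : star (- x) = - star x.
Proof. by apply/eqP; rewrite -addr_eq0 -starD addNr star0. Qed.

Lemma starB x y : star (x - y) = star x - star y.
Proof. by rewrite starD starN. Qed.

Lemma star1 : star (1 : A) = 1.
Proof. by rewrite -[LHS]mulr1 -{2}[1]starK -starM mulr1 starK. Qed.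

Lemma star_sum (I : Type) (s : seq I) (P : pred I) (F : I -> A) :
  star (\sum_(i <- s | P i) F i) = \sum_(i <- s | P i) star (F i).
Proof. exact: (big_morph (@star R A) (@starD R A) star0). Qed.

Lemma nrm_star a : nrm (star a) = nrm a.
Proof.
suff le x : nrm x <= nrm (star x).
  by apply/eqP; rewrite eq_le le -{2}[a]starK le.
have := bnM nrm_banach (star x) x; rewrite nrm_starM.
have [->|x0] := eqVneq (nrm x) 0; first by move=> _; exact: n0.
by rewrite expr2 ler_pM2r // lt_neqAle eq_sym x0 n0.
Qed.

Lemma norm_closed_star : norm_closed nrm (fun t => star t = t).
Proof.
apply: (norm_closed_eq nrm_banach (K := 2)) => // x y.
have -> : star x - x - (star y - y) = star (x - y) - (x - y).
  by rewrite starB; ncring.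
by apply: le_trans (bnB nrm_banach _ _) _; rewrite nrm_star; lra.
Qed.

Lemma norm_closed_fixl p : norm_closed nrm (fun t => p * t = t).
Proof.
apply: (norm_closed_eq nrm_banach (K := nrm p + 1)) => [|x y].
  by have := n0 p; lra.
have -> : p * x - x - (p * y - y) = p * (x - y) - (x - y) by ncring.
by apply: le_trans (bnB nrm_banach _ _) _; have := bnM nrm_banach p (x - y); lra.
Qed.

Lemma norm_closed_fixr p : norm_closed nrm (fun t => t * p = t).
Proof.
apply: (norm_closed_eq nrm_banach (K := nrm p + 1)) => [|x y].
  by have := n0 p; lra.
have -> : x * p - x - (y * p - y) = (x - y) * p - (x - y) by ncring.
by apply: le_trans (bnB nrm_banach _ _) _; have := bnM nrm_banach (x - y) p; lra.
Qed.

Lemma norm_closedP (X : set A) : norm_closed nrm X <-> closed X.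
Proof.
split=> [hX t ht | hX t ht].
  apply: hX => e e0; have [|u [Xu hu]] := ht (ball t e%:C%C).
    by apply: nbhsx_ballx; rewrite ltcR.
  by exists u => //; move: hu; rewrite -ball_normE /ball_ /= nrm_ltC.
apply: hX => B /nbhs_ballP[e /= e0 hB].
have e0' : e = (complex.Re e)%:C%C by rewrite RRe_real // gtr0_real.
move: e0; rewrite e0' ltcR => /ht[u Xu hu]; exists u; split=> //.
by apply: hB; rewrite -ball_normE /ball_ /= e0' nrm_ltC.
Qed.

Definition isproj p := p * p = p /\ star p = p.

Lemma isproj1 : isproj 1.
Proof. by split; [rewrite mulr1 | exact: star1]. Qed.

Lemma isprojC p : isproj p -> isproj (1 - p).
Proof.
move=> [pp ps]; split; last by rewrite starB star1 ps.
have -> : (1 - p) * (1 - p) = 1 - p - p + p * p by ncring.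
by rewrite pp subrK.
Qed.

Lemma isproj_nrm p : isproj p -> nrm p <= 1.
Proof.
move=> [pp ps]; have := nrm_starM p; rewrite ps pp; have := n0 p; nra.
Qed.

Lemma isproj_compress p x : isproj p -> nrm (p * x * p) <= nrm x.
Proof.
move=> hp; have h1 := isproj_nrm hp; have p0 := n0 p; have x0 := n0 x.
have := bnM nrm_banach (p * x) p; have := bnM nrm_banach p x.
have := n0 (p * x); nra.
Qed.

Lemma star_real (r : R) a : star (r%:C%C *: a) = r%:C%C *: star a.
Proof. by rewrite starZ conj_Creal //; apply/complex_realP; exists r. Qed.

(** The root is [p - 2 w], where [w = x / 4 + w ^ 2] comes from [banach_sqrt].
    As [w] lies in the corner of [p], the projection [p] takes the place of the
    unit. *)
Lemma cstar_sqrt p x : isproj p -> star x = x -> p * x = x -> x * p = x ->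
  nrm x < 1 -> exists k, [/\ star k = k, k * k = p - x, p * k = k, k * p = k &
    forall z, p * z = z * p -> x * z = z * x -> k * z = z * k].
Proof.
move=> [pp ps] xs px xp x1; pose x' : A := (4^-1 : R)%:C%C *: x.
have x4 : x' + x' + x' + x' = x.
  by rewrite /x' -!scalerDl -!rmorphD /= (_ : _ + _ = 1) ?scale1r //; field.
pose U t := ((star t = t /\ p * t = t) /\ t * p = t) /\
  forall z, x * z = z * x -> t * z = z * t.
have [w [[[ws pw] wp] wc] e] : exists2 w, U w & x' + w * w = w.
  apply: (banach_sqrt nrm_banach (s := nrm x)).
  - by rewrite n0.
  - rewrite nrmZr ger0_norm ?invr_ge0 //; lra.
  - apply: (@norm_closedI _ _ nrm (fun t => (star t = t /\ p * t = t) /\ t * p = t)).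
      apply: (@norm_closedI _ _ nrm (fun t => star t = t /\ p * t = t));
        last exact: norm_closed_fixr.
      by apply: (@norm_closedI _ _ nrm (fun t => star t = t));
        [exact: norm_closed_star | exact: norm_closed_fixl].
    move=> t ht z xz; apply: (norm_closed_comm nrm_banach) => e e0.
    by have [u hu ue] := ht e e0; exists u => //; apply: hu.
  - by split; [rewrite star0 mul0r mulr0 | move=> z _; rewrite mul0r mulr0].
  - move=> t [[[ts pt] tp] tc]; split; first split; first split.
    + by rewrite starD starM ts star_real xs.
    + by rewrite mulrDr mulrA pt -scalerAr px.
    + by rewrite mulrDl -mulrA tp -scalerAl xp.
    + move=> z xz; rewrite mulrDl mulrDr -scalerAl -scalerAr xz; congr (_ + _).
      by rewrite -mulrA (tc _ xz) mulrA (tc _ xz) mulrA.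
exists (p - w - w); split.
- by rewrite !starB ps ws.
- have -> : (p - w - w) * (p - w - w) = p * p - p * w - p * w - w * p - w * p
     + (w * w + w * w + w * w + w * w) by ncring.
  rewrite pp pw wp -x4.
  have ww : w * w = w - x' by rewrite -[in RHS]e; ncring.
  by rewrite ww; ncring.
- by rewrite !mulrBr pp pw.
- by rewrite !mulrBl pp wp.
- by move=> z pz /wc wz; rewrite !(mulrBl, mulrBr) pz wz.
Qed.

(** If [h] and [k] are commuting self-adjoint elements, then [h + i k] is normal
    and its modulus squared is [h ^ 2 + k ^ 2]; thus this sum controls [h],
    without any appeal to positivity or to spectral theory. *)
Lemma cstar_cos h k p (c : R) : star h = h -> star k = k -> h * k = k * h ->
  nrm p <= 1 -> 0 <= c -> h * h + k * k = c%:C%C *: p -> nrm h ^+ 2 <= c.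
Proof.
move=> hs ks hk p1 c0 e; pose u := h + 'i *: k.
have us : star u = h - 'i *: k by rewrite starD starZ hs ks conjCi scaleNr.
have uu : star u * u = c%:C%C *: p.
  rewrite us -e /u mulrBl !mulrDr -!scalerAl -!scalerAr hk scalerA.
  have -> : 'i * 'i = -1 :> R[i] by rewrite -expr2 sqrCi.
  by rewrite scaleN1r; ncring.
have hu : nrm u ^+ 2 <= c.
  by rewrite -nrm_starM uu nrmZr ger0_norm // ler_piMr.
have h2 : h + h = u + star u by rewrite us /u; ncring.
have : nrm (h + h) <= nrm u + nrm u.
  by rewrite h2; apply: le_trans (bnD nrm_banach _ _) _; rewrite nrm_star.
have -> : h + h = (2 : R)%:C%C *: h by rewrite (rmorphD _ 1 1) /= scalerDl !scale1r.
rewrite nrmZr ger0_norm //; have := n0 h; have := n0 u; nra.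
Qed.

(** In the corner of [p], the two norm bounds say that [y <= 0] and [y >= 0]. For
    [c > 0] they give commuting square roots [k1], [k2] with
    [(1 + c) k1 ^ 2 = c p + y] and [(1 + c) k2 ^ 2 = c p - y / T]; a combination
    of the two squares is a multiple of [p] that vanishes with [c], so
    [cstar_cos] makes [c p + y] small. *)
Lemma cstar_corner0 p y (T : R) : isproj p -> star y = y -> p * y = y ->
  y * p = y -> 0 < T -> nrm (T%:C%C *: p + y) <= T -> nrm (p - y) <= 1 -> y = 0.
Proof.
move=> hp ys py yp T0 hT h1; have [pp ps] := hp.
apply: (bn_le0 nrm_banach) => e e0; pose c := e / (2 + T).
have c0 : 0 < c by rewrite divr_gt0 //; lra.
have ec : e = (2 + T) * c by rewrite /c mulrC divfK //; apply/eqP; lra.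
pose s := (1 + c)^-1.
have s1 : s * (1 + c) = 1 by rewrite /s mulVf //; apply/eqP; lra.
have s0 : 0 < s by rewrite invr_gt0; lra.
pose a1 : A := s%:C%C *: (p - y).
pose a2 : A := (s / T)%:C%C *: (T%:C%C *: p + y).
have [||||k1 [k1s k1k pk1 k1p k1c]] := @cstar_sqrt p a1 hp.
- by rewrite star_real starB ps ys.
- by rewrite -scalerAr mulrBr pp py.
- by rewrite -scalerAl mulrBl pp yp.
- by rewrite nrmZr ger0_norm ?(ltW s0) //; nra.
have [||||k2 [k2s k2k pk2 k2p k2c]] := @cstar_sqrt p a2 hp.
- by rewrite star_real starD star_real ps ys.
- by rewrite -scalerAr mulrDr -scalerAr pp py.
- by rewrite -scalerAl mulrDl -scalerAl pp yp.
- have sT : 0 < s / T by rewrite divr_gt0.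
  rewrite nrmZr ger0_norm ?(ltW sT) //.
  apply: (@le_lt_trans _ _ (s / T * T)); first by rewrite ler_pM2l.
  by rewrite divfK ?gt_eqF //; nra.
have a12 : a1 * a2 = a2 * a1.
  have comm_py : (p - y) * (T%:C%C *: p + y) = (T%:C%C *: p + y) * (p - y).
    rewrite mulrDr [RHS]mulrDl -scalerAr -scalerAl.
    by congr (_ *: _ + _); rewrite mulrBl mulrBr py yp.
  by rewrite /a1 /a2 -!scalerAl -!scalerAr comm_py !scalerA mulrC.
pose k := (Num.sqrt T)%:C%C *: k2.
have kk : k * k = T%:C%C *: (p - a2).
  by rewrite /k -scalerAl -scalerAr scalerA -rmorphM /= -expr2 sqr_sqrtr ?(ltW T0) // k2k.
have k12 : k1 * k2 = k2 * k1.
  apply: k1c; first by rewrite pk2 k2p.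
  apply/esym/k2c; last by rewrite a12.
  by rewrite /a1 -scalerAl -scalerAr mulrBl mulrBr pp py yp.
have hs : nrm k1 ^+ 2 <= (1 + T) * (s * c).
  apply: (@cstar_cos k1 k p) => //.
  - by rewrite star_real k2s.
  - by rewrite /k -scalerAr -scalerAl k12.
  - exact: isproj_nrm.
  - exact: (mulr_ge0 (addr_ge0 ler01 (ltW T0)) (mulr_ge0 (ltW s0) (ltW c0))).
  rewrite k1k kk /a1 /a2 !scalerBr scalerA -rmorphM /= [T * _]mulrC divfK ?gt_eqF //.
  rewrite scalerDr scalerA -rmorphM /=.
  have -> : p - (s%:C%C *: p - s%:C%C *: y) +
    (T%:C%C *: p - ((s * T)%:C%C *: p + s%:C%C *: y)) =
    p + T%:C%C *: p - s%:C%C *: p - (s * T)%:C%C *: p by ncring.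
  rewrite -[X in X + _ - _ - _]scale1r -scalerDl -!scalerBl; congr (_ *: _).
  rewrite -[1]/(1 : R)%:C%C -rmorphD -!rmorphB /=; congr (_%:C%C).
  have -> : s * c = 1 - s by rewrite -s1; ring.
  by ring.
have ey : y = (1 + c)%:C%C *: (k1 * k1) - c%:C%C *: p.
  rewrite k1k /a1 scalerBr scalerA -rmorphM /= [_ * s]mulrC s1 scale1r.
  by rewrite rmorphD /= scalerDl scale1r; ncring.
rewrite ey; apply: le_trans (bnB nrm_banach _ _) _; rewrite !nrmZr !ger0_norm; try lra.
have := nrm_starM k1; rewrite k1s => ->; have := isproj_nrm hp; have := n0 p.
have : (1 + c) * nrm k1 ^+ 2 <= (1 + T) * c by nra.
rewrite ec; nra.
Qed.

(** Compressing [sum p_l + (1 - q) = 1] by [p_i] shows that [p_i p_j p_i] is the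
    negative of a sum of compressed projections. As it is itself a compressed
    projection, [cstar_corner0] makes it vanish, and it is [x^* x] for
    [x = p_j p_i]. *)
Lemma proj_sum_orth (I : finType) (Q : pred I) (p : I -> A) (q : A) :
  (forall i, isproj (p i)) -> isproj q -> \sum_(i | Q i) p i = q ->
  forall i j, Q i -> Q j -> i != j -> p i * p j = 0.
Proof.
move=> hp hq e i j Qi Qj ij; have [pi ps] := hp i; have [pj psj] := hp j.
pose y := p i * p j * p i; pose Q' l := [&& Q l, l != i & l != j].
pose T : R := (\sum_(l | Q' l) 1) + 1.
have T0 : 0 < T by rewrite ltr_wpDl // sumr_ge0.
have e' : q = p i + p j + \sum_(l | Q' l) p l.
  rewrite -e (bigD1 i) //= (bigD1 j) /=; last by rewrite Qj eq_sym.
  by rewrite addrA; congr (_ + _); apply: eq_bigl => l; rewrite /Q' andbA.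
have y0 : y = 0.
  apply: (@cstar_corner0 (p i) y T) => //.
  - by rewrite !starM ps psj mulrA.
  - by rewrite /y !mulrA pi.
  - by rewrite /y -mulrA pi.
  - pose z := \sum_(l | Q' l) (1 - p l) + q.
    have Tz : T%:C%C *: p i + y = p i * z * p i.
      have -> : z = T%:C%C *: 1 - (1 - p i - p j).
        rewrite /z /T sumrB e' rmorphD rmorph_sum rmorph1 scalerDl scale1r scaler_suml.
        have -> : \sum_(l | Q' l) (1 : R)%:C%C *: (1 : A) = \sum_(l | Q' l) 1.
          by apply: eq_bigr => l _; rewrite rmorph1 scale1r.
        by ncring.
      rewrite mulrBr mulrBl -scalerAr mulr1 -scalerAl pi; congr (_ + _).
      have -> : p i * (1 - p i - p j) * p i =
        p i * p i - p i * p i * p i - p i * p j * p i by ncring.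
      by rewrite pi pi subrr sub0r opprK.
    rewrite Tz; apply: le_trans (isproj_compress _ (hp i)) _.
    apply: le_trans (bnD nrm_banach _ _) _; apply: lerD; last exact: isproj_nrm.
    apply: le_trans (bn_sum nrm_banach _ _ _) _; apply: ler_sum => l _.
    exact/isproj_nrm/isprojC.
  - have -> : p i - y = p i * (1 - p j) * p i.
      by rewrite -[in LHS]pi /y; ncring.
    apply: le_trans (isproj_compress _ (hp i)) _; exact/isproj_nrm/isprojC.
have x0 : p j * p i = 0.
  apply: (bn_eq0 nrm_banach); apply/eqP; rewrite -sqrf_eq0 -nrm_starM.
  by rewrite starM ps psj !mulrA -(mulrA (p i)) pj -/y y0 (bn0 nrm_banach).
by rewrite -[LHS]starK starM ps psj x0 star0.
Qed.

End Norm.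

(** A self-adjoint [h] of norm less than [1] is the real part of the unitary
    [h + i sqrt (1 - h ^ 2)], and unitaries are mapped to unitaries. *)
Lemma star_hom_contractive (A D : cstarAlg R) (phi : A -> D) :
  star_hom phi -> phi 1 = 1 -> forall a, nrm (phi a) <= nrm a.
Proof.
move=> [lin mul st] phi1.
have phiD x y : phi (x + y) = phi x + phi y by have := lin 1 x y; rewrite !scale1r.
have phi0 : phi 0 = 0 by have /eqP := phiD 0 0; rewrite addr0 -subr_eq subrr eq_sym => /eqP.
have phiZ c x : phi (c *: x) = c *: phi x by rewrite -[c *: x]addr0 lin phi0 addr0.
have small a : nrm a < 1 -> nrm (phi a) <= 1.
  move=> a1; pose h := star a * a.
  have hs : star h = h by rewrite starM starK.
  have h1 : nrm h < 1 by rewrite nrm_starM; have := bn_ge0 (nrm_banach A) a; nra.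
  have [||||k [ks kk _ _ kc]] := @cstar_sqrt A 1 (h * h) (isproj1 A).
  - by rewrite starM hs.
  - by rewrite mul1r.
  - by rewrite mulr1.
  - by rewrite -{1}hs nrm_starM; have := bn_ge0 (nrm_banach A) h; nra.
  have hk : h * k = k * h by apply/esym/kc; rewrite ?mul1r ?mulr1 // mulrA.
  have : nrm (phi h) ^+ 2 <= 1.
    apply: (@cstar_cos _ (phi h) (phi k) 1); rewrite -?st -?mul ?hs ?ks ?hk //.
    - exact/isproj_nrm/isproj1.
    - by rewrite -phiD kk addrC subrK phi1 scale1r.
  rewrite /h mul st nrm_starM; have := bn_ge0 (nrm_banach D) (phi a).
  set x := nrm _ => x0 hx.
  have : x ^+ 2 <= 1 by have := sqr_ge0 x; nra.
  nra.
move=> a; apply/ler_addgt0Pr => e e0; have a0 := bn_ge0 (nrm_banach A) a.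
have s0 : 0 < nrm a + e by lra.
have := small ((nrm a + e)^-1%:C%C *: a);
  rewrite phiZ !nrmZr ger0_norm ?invr_ge0 ?(ltW s0) //.
rewrite -ler_pdivlMl ?invr_gt0 // invrK mulr1; apply.
by rewrite mulrC ltr_pdivrMr // mul1r ltrDl.
Qed.

End CStar.

(** * The graph relations *)

Section Sphere.
Variables (R : realType) (n : nat) (A : quantum_sphere R n).
Local Notation P := (@vproj R n A).
Local Notation S := (@eisom R n A).
Implicit Types (a b x y : A) (e f : edge n) (v w : 'I_n.+1) (d : int).

Let ck : ck_family P S := univ_ck (qs_univ A).
Let nB := nrm_banach A.

Lemma vproj_isproj v : isproj (P v).
Proof. exact: (ck_proj ck). Qed.

Lemma vproj_mul v w : P v * P w = if v == w then P v else 0.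
Proof. by case: eqP => [->|/eqP]; [case: (vproj_isproj w) | apply: (ck_orth ck)]. Qed.

Lemma vproj_sqr v : P v * P v = P v.
Proof. by rewrite vproj_mul eqxx. Qed.

Lemma vproj_star v : star (P v) = P v.
Proof. by case: (vproj_isproj v). Qed.

Lemma eisom_tgt e : S e * P (etgt e) = S e.
Proof. by rewrite -(ck_tgt ck) mulrA (ck_pisom ck). Qed.

Lemma eisom_isproj e : isproj (S e * star (S e)).
Proof. by split; [rewrite mulrA (ck_pisom ck) | rewrite starM starK]. Qed.

Let orth_src e f : esrc e = esrc f -> e != f -> star (S e) * S f = 0.
Proof.
move=> ef nef; have := @proj_sum_orth R A _ (fun g => esrc g == esrc f)
  (fun g => S g * star (S g)) (P (esrc f)) eisom_isproj (vproj_isproj _)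
  (ck_src ck _) e f; rewrite ef eqxx => /(_ isT isT nef) h.
have -> : star (S e) * S f =
    star (S e * star (S e) * S e) * (S f * star (S f) * S f).
  by rewrite !(ck_pisom ck).
have -> : star (S e * star (S e) * S e) * (S f * star (S f) * S f) =
    star (S e) * (S e * star (S e) * (S f * star (S f))) * S f.
  by rewrite !starM !starK !mulrA.
by rewrite h mulr0 mul0r.
Qed.

Lemma vproj_eisom v e : P v * S e = if v == esrc e then S e else 0.
Proof.
have src : P (esrc e) * S e = S e.
  rewrite -(ck_src ck) mulr_suml (bigD1 e) //= (ck_pisom ck) big1 ?addr0 // => f.
  by move=> /andP[/eqP fe nfe]; rewrite -mulrA orth_src ?mulr0.
by case: eqP => [->//|/eqP ve]; rewrite -src mulrA vproj_mul (negPf ve) mul0r.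
Qed.

(** For edges with the same source this is [proj_sum_orth], applied to the
    Cuntz-Krieger relation at that vertex. *)
Lemma eisom_orth e f : star (S e) * S f = if e == f then P (etgt e) else 0.
Proof.
case: eqP => [->|/eqP ef]; first exact: (ck_tgt ck).
have [src|src] := eqVneq (esrc e) (esrc f); first exact: orth_src.
have := vproj_eisom (esrc e) e; rewrite eqxx => <-.
by rewrite starM vproj_star -mulrA vproj_eisom (negPf src) mulr0.
Qed.

Lemma star_eisom_vproj v e :
  star (S e) * P v = if v == esrc e then star (S e) else 0.
Proof. by rewrite -{1}vproj_star -starM vproj_eisom; case: eqP; rewrite ?star0. Qed.

Lemma vproj_star_eisom v e :
  P v * star (S e) = if v == etgt e then star (S e) else 0.
Proof.
have tgt : P (etgt e) * star (S e) = star (S e).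
  by rewrite -{1}vproj_star -starM eisom_tgt.
by case: eqP => [->//|/eqP ve]; rewrite -tgt mulrA vproj_mul (negPf ve) mul0r.
Qed.

(** The sum of the vertex projections is a unit for the generators, hence for
    the closed *-algebra that they generate, which is everything. *)
Lemma vproj_sum : \sum_v P v = 1.
Proof.
set p := \sum_v P v.
have pP v : p * P v = P v.
  rewrite /p mulr_suml (bigD1 v) //= vproj_sqr big1 ?addr0 // => w wv.
  by rewrite vproj_mul (negPf wv).
have Pp v : P v * p = P v.
  rewrite /p mulr_sumr (bigD1 v) //= vproj_sqr big1 ?addr0 // => w wv.
  by rewrite vproj_mul eq_sym (negPf wv).
have ps : star p = p by rewrite star_sum; apply: eq_bigr => v _; rewrite vproj_star.
have pS e : p * S e = S e.
  by have := vproj_eisom (esrc e) e; rewrite eqxx => <-; rewrite mulrA pP.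
have Sp e : S e * p = S e by rewrite -(eisom_tgt e) -mulrA Pp.
suff [+ _] : p * 1 = 1 /\ 1 * p = 1 by rewrite mulr1.
apply: (univ_gen (qs_univ A) (X := fun a => p * a = a /\ a * p = a)) => //.
split.
- apply/norm_closedP.
  by apply: (@norm_closedI _ _ _ (fun a => p * a = a) (fun a => a * p = a));
    [exact: norm_closed_fixl | exact: norm_closed_fixr].
- by rewrite mulr0 mul0r.
- by move=> c x y [px xp] [py yp]; rewrite mulrDr mulrDl -scalerAr -scalerAl px xp py yp.
- by move=> x y [px xp] [py yp]; rewrite mulrA px -mulrA yp.
- by move=> x [px xp]; rewrite -{1 2}ps -!starM px xp.
Qed.

Lemma eisom_sum : \sum_e S e * star (S e) = 1.
Proof.
rewrite -vproj_sum (partition_big (@esrc n) predT) //=.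
by apply: eq_bigr => v _; rewrite -(ck_src ck).
Qed.

(** * Degrees *)

Definition deg d a := forall z, `|z| = 1 -> gauge z a = z ^ d *: a.

Lemma gauge_nrm z a : `|z| = 1 -> nrm (gauge z a) <= nrm a.
Proof.
move=> z1; apply: star_hom_contractive (gauge1 A z1) _.
exact: (gauge_hom (qs_gauge A)).
Qed.

Lemma gaugeD z a b : `|z| = 1 -> gauge z (a + b) = gauge z a + gauge z b.
Proof. by move=> z1; have := gauge_lin z1 1 a b; rewrite !scale1r. Qed.

Lemma gaugeZ z c a : `|z| = 1 -> gauge z (c *: a) = c *: gauge z a.
Proof. by move=> z1; have := gauge_lin z1 c a 0; rewrite gauge0 // !addr0. Qed.

Lemma unit_neq0 (z : R[i]) : `|z| = 1 -> z != 0.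
Proof. by move=> z1; rewrite -normr_eq0 z1 oner_eq0. Qed.

Lemma unit_expz d (z : R[i]) : `|z| = 1 -> `|z ^ d| = 1.
Proof.
by move=> z1; case: d => k; rewrite /exprz ?normfV normrX z1 expr1n ?invr1.
Qed.

Lemma deg_0 d : deg d 0.
Proof. by move=> z z1; rewrite gauge0 // scaler0. Qed.

Lemma degB d a b : deg d a -> deg d b -> deg d (a - b).
Proof. by move=> ha hb z z1; rewrite gaugeB // ha // hb // scalerBr. Qed.

Lemma degD d a b : deg d a -> deg d b -> deg d (a + b).
Proof. by move=> ha hb z z1; rewrite gaugeD // ha // hb // scalerDr. Qed.

Lemma deg_sum d (I : Type) (s : seq I) (Q : pred I) (F : I -> A) :
  (forall i, Q i -> deg d (F i)) -> deg d (\sum_(i <- s | Q i) F i).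
Proof. by move=> h; apply: (big_ind (deg d)) => //; [exact: deg_0 | exact: degD]. Qed.

Lemma degZ d c a : deg d a -> deg d (c *: a).
Proof. by move=> ha z z1; rewrite gaugeZ // ha // !scalerA mulrC. Qed.

Lemma degM d d' a b : deg d a -> deg d' b -> deg (d + d') (a * b).
Proof.
move=> ha hb z z1; rewrite gaugeM // ha // hb // -scalerAl -scalerAr scalerA.
by rewrite expfzDr // unit_neq0.
Qed.

Lemma deg_star d a : deg d a -> deg (- d) (star a).
Proof.
move=> ha z z1; have [_ _ ->] := gauge_hom (qs_gauge A) z1.
rewrite ha // starZ; congr (_ *: _).
have zc : z^* = z^-1.
  apply: (mulfI (unit_neq0 z1)); rewrite -normCK z1 expr1n divff //.
  exact: unit_neq0.
by rewrite -exprz_inv -zc; case: d {ha} => k;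
  rewrite /exprz ?rmorphV ?rmorphXn ?unitfE ?expf_neq0 ?unit_neq0.
Qed.

Lemma deg1 : deg 0 1.
Proof. by move=> z z1; rewrite gauge1 // expr0z scale1r. Qed.

Lemma deg_vproj v : deg 0 (P v).
Proof. by move=> z z1; rewrite (gauge_vproj (qs_gauge A)) // expr0z scale1r. Qed.

Lemma deg_eisom e : deg 1 (S e).
Proof. by move=> z z1; rewrite (gauge_eisom (qs_gauge A)). Qed.

Lemma deg_star_eisom e : deg (-1) (star (S e)).
Proof. exact/deg_star/deg_eisom. Qed.

Lemma deg_closed d : norm_closed (@nrm R A) (deg d).
Proof.
move=> t ht z z1.
apply: (norm_closed_eq nB (f := gauge z) (g := fun a => z ^ d *: a) (K := 2)) => //.
  move=> x y; have -> : gauge z x - z ^ d *: x - (gauge z y - z ^ d *: y)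
    = gauge z (x - y) - z ^ d *: (x - y) by rewrite gaugeB // scalerBr; ncring.
  apply: le_trans (bnB nB _ _) _; rewrite (nrm1Z _ (unit_expz d z1)).
  by have := gauge_nrm (x - y) z1; lra.
by move=> e e0; have [u hu ue] := ht e e0; exists u => //; apply: hu.
Qed.

Lemma unit_root_opp1 d : d != 0 -> exists2 z : R[i], `|z| = 1 & z ^ d = -1.
Proof.
suff pos k : (0 < k)%N -> exists2 z : R[i], `|z| = 1 & z ^+ k = -1.
  case: d => [k|k] d0; first by have [|z z1 zk] := pos k; [rewrite lt0n | exists z].
  have [//|z z1 zk] := pos k.+1; exists z^-1; first by rewrite normfV z1 invr1.
  by rewrite /exprz exprVn invrK.
move=> k0; exists (k.-root (-1)); last by rewrite rootCK.
apply/eqP; rewrite -(@pexpr_eq1 _ _ k) // -normrX rootCK // normrN1.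
by [].
Qed.

(** Averaging with [(1 + gauge z) / 2], where [z ^ d = -1], is a contraction
    that kills the component of degree [d] and fixes the one of degree [0]. *)
Lemma deg0_contractive (s : seq (int * A)) c : deg 0 c ->
  (forall p, p \in s -> p.1 != 0 /\ deg p.1 p.2) ->
  nrm c <= nrm (c + \sum_(p <- s) p.2).
Proof.
elim: {s}(size s) {-2}s (erefl (size s)) =>
  [[|//] _ hc hs|k IH [//|[d h] s] [sz] hc hs]; first by rewrite big_nil addr0.
have [/= d0 hd] := hs _ (mem_head _ _).
have [z z1 zd] := unit_root_opp1 d0.
pose half : R[i] := (2^-1 : R)%:C%C.
pose T x := half *: (x + gauge z x).
have hh : half + half = 1 by rewrite -rmorphD /= (_ : _ + _ = 1) //; field.
have TD x y : T (x + y) = T x + T y by rewrite /T gaugeD // addrACA scalerDr.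
have T0 : T 0 = 0 by rewrite /T gauge0 // addr0 scaler0.
have Tn x : nrm (T x) <= nrm x.
  rewrite nrmZr ger0_norm ?invr_ge0 //.
  by have := bnD nB x (gauge z x); have := gauge_nrm x z1; lra.
apply: le_trans (Tn _); rewrite big_cons !TD.
have -> : T c = c by rewrite /T hc // expr0z scale1r scalerDr -scalerDl hh scale1r.
have -> : T h = 0 by rewrite /T hd // zd scaleN1r subrr scaler0.
rewrite add0r (big_morph T TD T0).
pose s' := [seq (p.1, T p.2) | p <- s].
have -> : \sum_(p <- s) T p.2 = \sum_(p <- s') p.2 by rewrite big_map.
apply: IH => //; first by rewrite size_map.
move=> _ /mapP[p ps ->] /=; have [|p0 hp] := hs p; first by rewrite inE ps orbT.
split=> //; rewrite /T hp // -{1}[p.2]scale1r -scalerDl scalerA.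
exact: degZ.
Qed.

(** * The approximately finite-dimensional core *)

(** The map [c |-> c a0] multiplies distances by the norm of [a0], so the
    coefficients of approximations form a Cauchy sequence. *)
Lemma complex_span_closed a0 : norm_closed (@nrm R A) (fun a => exists c, a = c *: a0).
Proof.
have [-> t ht|a00 t ht] := eqVneq a0 0.
  exists 0; rewrite scale0r; apply: (norm_closed0 nB) => e /ht[u [c ->] h].
  by exists 0 => //; move: h; rewrite scaler0.
have N0 : 0 < nrm a0.
  rewrite lt_neqAle eq_sym (bn_ge0 nB) andbT; apply: contraNneq a00.
  by move/(bn_eq0 nB) ->.
have /choice[c hc] (k : nat) : exists c, nrm (t - c *: a0) < nrm a0 * k.+1%:R^-1.
  have [|u [c ->] h] := ht (nrm a0 * k.+1%:R^-1); last by exists c.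
  by rewrite mulr_gt0 // invr_gt0.
have hcc k l : complex.Re `|c k - c l| < k.+1%:R^-1 + l.+1%:R^-1.
  rewrite -(ltr_pM2l N0) mulrC -nrmZ scalerBl mulrDr.
  have -> : c k *: a0 - c l *: a0 = (t - c l *: a0) - (t - c k *: a0) by ncring.
  by apply: le_lt_trans (bnB nB _ _) _; rewrite addrC ltrD.
have inv_small (e : R) : 0 < e -> exists N, forall k, (N <= k)%N -> k.+1%:R^-1 < e.
  move=> e0; exists (Num.truncn e^-1) => k Nk.
  rewrite -[e]invrK ltf_pV2 ?posrE ?invr_gt0 //.
  by apply: lt_le_trans (truncnS_gt _) _; rewrite ler_nat.
have cauchy (u : nat -> R) : (forall k l, `|u k - u l| <= complex.Re `|c k - c l|) ->
    exists r : R, forall e : R, 0 < e ->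
      exists n0, forall k, (n0 <= k)%N -> `|r - u k| < e.
  move=> hu; apply: (@cauchy_seq_lim R R^o u) => e e0.
  have [|N hN] := inv_small (e / 2); first by rewrite divr_gt0.
  exists N => k Nk; apply: le_lt_trans (hu _ _) _; apply: lt_le_trans (hcc _ _) _.
  by apply/ltW; rewrite [ltRHS]splitr ltrD ?hN.
have [|r hr] := cauchy (fun k => complex.Re (c k)).
  move=> k l; case: (c k) (c l) => [x y] [x' y'].
  rewrite normc_def /= -[`|x - x'|]sqrtr_sqr ler_wsqrtr //.
  by rewrite lerDl sqr_ge0.
have [|s hs] := cauchy (fun k => complex.Im (c k)).
  move=> k l; case: (c k) (c l) => [x y] [x' y'].
  rewrite normc_def /= -[`|y - y'|]sqrtr_sqr ler_wsqrtr //.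
  by rewrite lerDr sqr_ge0.
exists (Complex r s); apply/eqP; rewrite -subr_eq0; apply/eqP/(bn_le0 nB) => e e0.
have e1 : 0 < e / (3 * nrm a0) by rewrite divr_gt0 // mulr_gt0.
have e3 : e = 3 * (e / (3 * nrm a0) * nrm a0) by field; apply/eqP; lra.
set e' := e / _ in e1 e3.
have [n1 h1] := hr _ e1; have [n2 h2] := hs _ e1; have [n3 h3] := inv_small _ e1.
pose k := maxn n1 (maxn n2 n3).
have {}h1 := h1 k (leq_maxl _ _).
have {}h2 := h2 k (leq_trans (leq_maxl _ _) (leq_maxr _ _)).
have {}h3 := h3 k (leq_trans (leq_maxr _ _) (leq_maxr _ _)).
have hk := hc k.
have -> : t - Complex r s *: a0 = (t - c k *: a0) - (Complex r s - c k) *: a0.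
  by rewrite scalerBl; ncring.
apply: le_trans (bnB nB _ _) _; rewrite nrmZ.
have : complex.Re `|Complex r s - c k| <= 2 * e'.
  move: h1 h2; case: (c k) => [x y] h1 h2; rewrite /= in h1 h2.
  have e2 : 0 <= 2 * e' by lra.
  rewrite normc_def /= -(ger0_norm e2) -sqrtr_sqr ler_wsqrtr //.
  have := normr_ge0 (r - x); have := normr_ge0 (s - y).
  rewrite -(real_normK (num_real (r - x))) -(real_normK (num_real (s - y))); nra.
move=> hd; have {hd} := ler_wpM2r (ltW N0) hd.
have {}hk : nrm (t - c k *: a0) < nrm a0 * e'.
  by apply: lt_trans hk _; rewrite ltr_pM2l.
move=> hd; rewrite e3; lra.
Qed.

(** The span of the vertex projections, described corner by corner; as
    [sum_v P v = 1] this determines the element, and each condition is closed. *)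
Definition vspan a := forall v, exists c, P v * a = c *: P v.

Lemma vspanP a : vspan a -> exists c : 'I_n.+1 -> R[i], a = \sum_v c v *: P v.
Proof.
move=> /choice[c hc]; exists c; rewrite -[LHS]mul1r -vproj_sum mulr_suml.
exact: eq_bigr.
Qed.

Lemma vspan_comb (c : 'I_n.+1 -> R[i]) : vspan (\sum_v c v *: P v).
Proof.
move=> v; exists (c v); rewrite mulr_sumr (bigD1 v) //= -scalerAr vproj_sqr.
by rewrite big1 ?addr0 // => w wv; rewrite -scalerAr vproj_mul eq_sym (negPf wv) scaler0.
Qed.

Lemma vspan_0 : vspan 0.
Proof. by move=> v; exists 0; rewrite mulr0 scale0r. Qed.

Lemma vspanD a b : vspan a -> vspan b -> vspan (a + b).
Proof.
by move=> ha hb v; have [c hc] := ha v; have [d hd] := hb v; exists (c + d);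
  rewrite mulrDr hc hd scalerDl.
Qed.

Lemma vspanZ c a : vspan a -> vspan (c *: a).
Proof.
by move=> ha v; have [d hd] := ha v; exists (c * d); rewrite -scalerAr hd scalerA.
Qed.

Lemma vspanM a b : vspan a -> vspan b -> vspan (a * b).
Proof.
move=> ha hb v; have [c hc] := ha v; have [d hd] := hb v; exists (c * d).
by rewrite mulrA hc -scalerAl hd scalerA.
Qed.

Lemma vspan_star a : vspan a -> vspan (star a).
Proof.
move=> /vspanP[c ->]; rewrite star_sum.
rewrite (eq_bigr (fun v => (c v)^* *: P v)) => [|v _]; last by rewrite starZ vproj_star.
exact: vspan_comb.
Qed.

Lemma vspan_vproj v : vspan (P v).
Proof.
move=> w; rewrite vproj_mul; case: eqP => [->|_]; first by exists 1; rewrite scale1r.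
by exists 0; rewrite scale0r.
Qed.

Lemma vspan_deg a : vspan a -> deg 0 a.
Proof. by move=> /vspanP[c ->]; apply: deg_sum => v _; apply/degZ/deg_vproj. Qed.

Lemma vspan_compress a e f : vspan a -> vspan (star (S e) * a * S f).
Proof.
move=> ha; have [c hc] := ha (esrc e).
have -> : star (S e) * a * S f = c *: (star (S e) * S f).
  have := star_eisom_vproj (esrc e) e; rewrite eqxx => {1}<-.
  by rewrite -(mulrA (star _)) hc -scalerAr star_eisom_vproj eqxx scalerAl.
apply: vspanZ; rewrite eisom_orth; case: eqP => _; [exact: vspan_vproj | exact: vspan_0].
Qed.

Lemma vspan_closed : norm_closed (@nrm R A) vspan.
Proof.
move=> t ht v.
apply: (@norm_closed_lip R _ (@nrm R A) _ (@nrm R A) (fun a => P v * a) (nrm (P v))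
  (fun a => exists c, a = c *: P v)) => [|x y||e /ht[u hu ue]].
- exact: bn_ge0.
- by rewrite -mulrBr; exact: (bnM nB).
- exact: complex_span_closed.
- by exists u.
Qed.

(** [core k l] is the span of the [S_mu S_nu^*] for words [mu] and [nu] of lengths
    [k] and [l] in the edges, described through coefficients: all the
    [S_mu^* a S_nu] are combinations of vertex projections. Words that are not
    paths have [S_mu = 0] and impose nothing. *)
Fixpoint core0 (l : nat) a : Prop :=
  if l is l'.+1 then forall e, core0 l' (a * S e) else vspan a.
Fixpoint core (k l : nat) a : Prop :=
  if k is k'.+1 then forall e, core k' l (star (S e) * a) else core0 l a.

Lemma core_r k l a : core k l.+1 a <-> forall e, core k l (a * S e).
Proof.
elim: k a => [|k IH] a //; split=> h e.
  by move=> f; rewrite mulrA; apply: (proj1 (IH _) (h f)).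
by apply/IH => f; rewrite -mulrA; apply: h.
Qed.

Lemma core_0 k l : core k l 0.
Proof.
by elim: k => [|k IH]; [elim: l => [|l IH] |] => /=;
  [exact: vspan_0| |] => e; rewrite ?mul0r ?mulr0.
Qed.

Lemma coreD k l a b : core k l a -> core k l b -> core k l (a + b).
Proof.
elim: k a b => [|k IH] a b; last by move=> ha hb e; rewrite mulrDr; apply: IH.
by elim: l a b => [|l IH] a b; [exact: vspanD | move=> ha hb e; rewrite mulrDl; apply: IH].
Qed.

Lemma coreZ k l c a : core k l a -> core k l (c *: a).
Proof.
elim: k a => [|k IH] a; last by move=> ha e; rewrite -scalerAr; apply: IH.
by elim: l a => [|l IH] a; [exact: vspanZ | move=> ha e; rewrite -scalerAl; apply: IH].
Qed.

Lemma core_sum k l (I : Type) (s : seq I) (Q : pred I) (F : I -> A) :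
  (forall i, Q i -> core k l (F i)) -> core k l (\sum_(i <- s | Q i) F i).
Proof. by move=> h; apply: (big_ind (core k l)) => //; [exact: core_0 | exact: coreD]. Qed.

Lemma coreB k l a b : core k l a -> core k l b -> core k l (a - b).
Proof. by move=> ha hb; apply: coreD => //; rewrite -scaleN1r; apply: coreZ. Qed.

Lemma insert_eisom a b : a * b = \sum_e (a * S e) * (star (S e) * b).
Proof.
rewrite -[a in LHS]mulr1 -eisom_sum mulr_sumr mulr_suml.
by apply: eq_bigr => e _; rewrite !mulrA.
Qed.

(** Insert [1 = sum_e S_e S_e^*] between the factors, [l] times. *)
Lemma coreM k l m a b : core k l a -> core l m b -> core k m (a * b).
Proof.
elim: l k m a b => [|l IH] k m a b ha hb; last first.
  rewrite insert_eisom; apply: core_sum => e _.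
  by apply: IH; [move/core_r: ha | apply: hb].
elim: k a ha => [|k IH] a ha; last by move=> e; rewrite mulrA; apply: IH.
by elim: m b hb => [|m IH] b hb; [exact: vspanM | move=> e; rewrite -mulrA; apply: IH].
Qed.

Lemma core_star k l a : core k l a -> core l k (star a).
Proof.
elim: k l a => [|k IH] l a ha.
  elim: l a ha => [|l IH] a ha; first exact: vspan_star.
  by move=> e; rewrite -starM; apply: IH; apply: ha.
by apply/core_r => e; rewrite -{1}[S e]starK -starM; apply: IH; apply: ha.
Qed.

(** The spans increase because a combination of vertex projections, compressed by
    two edges, is again one ([vspan_compress]). *)
Lemma coreS k l a : core k l a -> core k.+1 l.+1 a.
Proof.
elim: k a => [|k IH] a ha; last by move=> e; apply: IH; apply: ha.
elim: l a ha => [|l IH] a ha.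
  by move=> e f; rewrite -/core; apply: vspan_compress.
by apply/core_r => e; apply: IH; apply: ha.
Qed.

Lemma core_add k l m a : core k l a -> core (k + m)%N (l + m)%N a.
Proof. by elim: m => [|m IH] h; rewrite ?addn0 // !addnS; apply/coreS/IH. Qed.

Lemma core_deg k l a : core k l a -> deg (k%:Z - l%:Z) a.
Proof.
elim: k a => [|k IH] a ha.
  elim: l a ha => [|l IH] a ha; first exact: vspan_deg.
  rewrite -[a]mulr1 -eisom_sum mulr_sumr; apply: deg_sum => e _; rewrite mulrA.
  have -> : 0%:Z - l.+1%:Z = (0%:Z - l%:Z) + -1 by lia.
  by apply: degM; [apply: IH; apply: ha | exact: deg_star_eisom].
rewrite -[a]mul1r -eisom_sum mulr_suml; apply: deg_sum => e _; rewrite -mulrA.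
have -> : k.+1%:Z - l%:Z = 1 + (k%:Z - l%:Z) by lia.
by apply: degM; [exact: deg_eisom | apply: IH; apply: ha].
Qed.

Lemma core_closed k l : norm_closed (@nrm R A) (core k l).
Proof.
elim: k => [|k IH]; first elim: l => [|l IH]; first exact: vspan_closed.
  move=> t ht e.
  apply: (@norm_closed_lip R _ (@nrm R A) _ (@nrm R A) (fun a => a * S e) (nrm (S e))
    (core 0 l)) => [|x y|//|e' /ht[u hu ue]].
  - exact: bn_ge0.
  - by rewrite -mulrBl mulrC; exact: (bnM nB).
  - by exists u => //; apply: hu.
move=> t ht e.
apply: (@norm_closed_lip R _ (@nrm R A) _ (@nrm R A) (fun a => star (S e) * a)
  (nrm (star (S e))) (core k l)) => [|x y|//|e' /ht[u hu ue]].
- exact: bn_ge0.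
- by rewrite -mulrBr; exact: (bnM nB).
- by exists u => //; apply: hu.
Qed.

Lemma core_eisom e : core 1 0 (S e).
Proof.
move=> f /=; rewrite eisom_orth.
by case: eqP => _; [exact: vspan_vproj | exact: vspan_0].
Qed.

(** This is the *-algebra generated by the edges, presented as sums of terms
    whose degrees are visible. *)
Inductive graphpoly : A -> Prop :=
| graphpoly0 : graphpoly 0
| graphpolyD k l a x : core k l a -> graphpoly x -> graphpoly (a + x).

Lemma core_graphpoly k l a : core k l a -> graphpoly a.
Proof. by move=> h; rewrite -[a]addr0; apply: graphpolyD h graphpoly0. Qed.

Lemma graphpoly_add x y : graphpoly x -> graphpoly y -> graphpoly (x + y).
Proof.
move=> hx hy; elim: hx => [|k l a z ha _ IH]; first by rewrite add0r.
by rewrite -addrA; apply: graphpolyD ha IH.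
Qed.

Lemma graphpolyZ c x : graphpoly x -> graphpoly (c *: x).
Proof.
elim=> [|k l a z ha _ IH]; first by rewrite scaler0; exact: graphpoly0.
by rewrite scalerDr; apply: graphpolyD (coreZ c ha) IH.
Qed.

Lemma graphpolyM x y : graphpoly x -> graphpoly y -> graphpoly (x * y).
Proof.
move=> hx hy; elim: hx => [|k l a z ha _ IH].
  by rewrite mul0r; exact: graphpoly0.
rewrite mulrDl; apply: graphpoly_add IH.
elim: hy => [|k' l' b t hb _ IH]; first by rewrite mulr0; exact: graphpoly0.
rewrite mulrDr; apply: graphpoly_add IH.
apply: (@core_graphpoly (k + k') (l' + l)).
by apply: (coreM (l := (l + k')%N)); [exact: core_add | rewrite addnC; exact: core_add].
Qed.

Lemma graphpoly_star x : graphpoly x -> graphpoly (star x).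
Proof.
elim=> [|k l a z ha _ IH]; first by rewrite star0; exact: graphpoly0.
by rewrite starD; apply: graphpolyD (core_star ha) IH.
Qed.

Lemma graphpoly_decomp x : graphpoly x -> exists k a (s : seq (int * A)),
  [/\ core k k a, forall p, p \in s -> p.1 != 0 /\ deg p.1 p.2 &
      x = a + \sum_(p <- s) p.2].
Proof.
elim=> [|k l a z ha _ [m [b [s [hb hs ->]]]]].
  by exists 0%N, 0, [::]; split=> //; [exact: core_0 | rewrite big_nil addr0].
have [kl|kl] := eqVneq k l.
  exists (k + m)%N, (a + b), s; split=> //; last by rewrite addrA.
  apply: coreD; first by apply: core_add; rewrite {2}kl.
  by rewrite addnC; apply: core_add.
exists m, b, ((k%:Z - l%:Z, a) :: s); split=> //; last first.
  by rewrite big_cons /= addrCA.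
move=> p; rewrite inE => /orP[/eqP->|]; last exact: hs.
by split=> /=; [lia | exact: core_deg].
Qed.

Lemma scale_gt0 (K r : R) : 0 <= K -> 0 < r -> 0 < r / (2 * (K + 1)).
Proof. by move=> K0 r0; rewrite divr_gt0 // mulr_gt0 // ltr_wpDl. Qed.

Lemma scale_lt (K r t : R) : 0 <= K -> 0 < r -> t < r / (2 * (K + 1)) -> K * t < r / 2.
Proof. by move=> K0 r0; rewrite ltr_pdivlMr; [nra | lra]. Qed.

Lemma graphpoly_dense a : forall r : R, 0 < r -> exists2 x, graphpoly x & nrm (a - x) < r.
Proof.
pose X a := forall r : R, 0 < r -> exists2 x, graphpoly x & nrm (a - x) < r.
have X1 x : graphpoly x -> X x by move=> hx r r0; exists x; rewrite // subrr (bn0 nB).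
apply: (univ_gen (qs_univ A) (X := X)) a => [|v|e]; last 2 first.
- by apply: X1; apply: (@core_graphpoly 0 0); exact: vspan_vproj.
- by apply: X1; apply: core_graphpoly (core_eisom e).
split.
- apply/norm_closedP => t ht r r0.
  have [|u Xu hu] := ht (r / 2); first by lra.
  have [|x hx ux] := Xu (r / 2); first by lra.
  by exists x => //; have := bn_tri nB u t x; lra.
- exact/X1/graphpoly0.
- move=> c x y Xx Xy r r0.
  have c0 : 0 <= complex.Re `|c| by rewrite -lecR RRe_real ?normr_real // normr_ge0.
  have [u hu ux] := Xx _ (scale_gt0 c0 r0); have [|v hv vy] := Xy (r / 2); first by lra.
  exists (c *: u + v); first by apply: graphpoly_add => //; apply: graphpolyZ.
  have -> : c *: x + y - (c *: u + v) = c *: (x - u) + (y - v).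
    by rewrite scalerBr; ncring.
  apply: le_lt_trans (bnD nB _ _) _; rewrite nrmZ.
  by have := scale_lt c0 r0 ux; lra.
- move=> x y Xx Xy r r0.
  have [u hu ux] := Xx _ (scale_gt0 (bn_ge0 nB y) r0).
  have [v hv vy] := Xy _ (scale_gt0 (bn_ge0 nB u) r0).
  exists (u * v); first exact: graphpolyM.
  have -> : x * y - u * v = (x - u) * y + u * (y - v) by ncring.
  apply: le_lt_trans (bnD nB _ _) _.
  have := scale_lt (bn_ge0 nB y) r0 ux; have := scale_lt (bn_ge0 nB u) r0 vy.
  have := bnM nB (x - u) y; have := bnM nB u (y - v); lra.
- move=> x Xx r r0; have [u hu ux] := Xx r r0.
  by exists (star u); [exact: graphpoly_star | rewrite -starB nrm_star].
Qed.

(** In an approximation by a sum of homogeneous terms, those of nonzero degree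
    can be dropped: by [deg0_contractive] the distance does not increase. *)
Lemma core_dense a : deg 0 a -> forall r : R, 0 < r ->
  exists k x, core k k x /\ nrm (a - x) < r.
Proof.
move=> ha r r0; have [x hx ax] := graphpoly_dense a r0.
have [k [b [s [hb hs ex]]]] := graphpoly_decomp hx.
exists k, b; split=> //; apply: le_lt_trans ax; rewrite ex.
pose s' := [seq (p.1, - p.2) | p <- s].
have -> : a - (b + \sum_(p <- s) p.2) = (a - b) + \sum_(p <- s') p.2.
  by rewrite big_map sumrN opprD addrA.
apply: deg0_contractive.
  by have := core_deg hb; rewrite subrr => hb0; apply: degB.
move=> _ /mapP[p /hs[p0 hp] ->]; split=> //=.
by rewrite -[- p.2]sub0r; apply: degB => //; exact: deg_0.
Qed.

End Sphere.

(** * Isomorphism of modules given by idempotents *)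

Section IdemIso.
Variable B : pzRingType.

Lemma idem_hom_mx (c d : idem B) (F : idem_mod c -> idem_mod d) : linear F ->
  exists u : 'M[B]_(idem_size c, idem_size d),
    forall x : idem_mod c, idem_val (F x) = idem_val x *m u.
Proof.
move=> linF.
have fixc (v : 'rV[B]_(idem_size c)) : v *m idem_mx c \in @idem_fix B c.
  by rewrite unfold_in -mulmxA idemP.
pose g v := idem_val (F (IdemMod (fixc v))).
have g_lin : linear g.
  move=> a v w; rewrite /g -idem_val_linear -linF; congr (idem_val (F _)).
  by apply: idem_val_inj; rewrite /= mulmxDl -scalemxAl.
pose gL : {linear _ -> _} := HB.pack g (GRing.isLinear.Build _ _ _ _ g g_lin).
exists (lin1_mx gL) => x; rewrite mul_rV_lin1 /= /g; congr (idem_val (F _)).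
by apply: idem_val_inj; rewrite /= idem_valP.
Qed.

(** Linear maps between these modules are multiplications by matrices, so an
    isomorphism and its inverse amount to a Murray-von Neumann equivalence. *)
Lemma idem_isoP (c d : idem B) : mod_iso (idem_mod c) (idem_mod d) <->
  exists (u : 'M[B]_(idem_size c, idem_size d))
         (v : 'M[B]_(idem_size d, idem_size c)),
    u *m v = idem_mx c /\ v *m u = idem_mx d.
Proof.
split=> [[F [linF [G FK GK]]]|[u [v [uv vu]]]].
  have linG : linear G.
    by move=> a x y; apply: (can_inj FK); rewrite GK linF !GK.
  have [u hu] := idem_hom_mx linF; have [v hv] := idem_hom_mx linG.
  have row_fix (e : idem B) i : row i (idem_mx e) \in @idem_fix B e.
    by rewrite unfold_in -row_mul idemP.
  exists (idem_mx c *m u), (idem_mx d *m v); split; apply/row_matrixP => i.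
    pose x := IdemMod (row_fix c i).
    have -> : row i (idem_mx c) = idem_val (G (F x)) by rewrite FK.
    rewrite hv -[idem_val (F x)]idem_valP hu -!mulmxA !row_mul.
    by rewrite !mulmxA.
  pose x := IdemMod (row_fix d i).
  have -> : row i (idem_mx d) = idem_val (F (G x)) by rewrite GK.
  rewrite hu -[idem_val (G x)]idem_valP hv -!mulmxA !row_mul.
  by rewrite !mulmxA.
have inF (x : idem_mod c) : idem_val x *m u \in @idem_fix B d.
  by rewrite unfold_in -vu mulmxA -(mulmxA (idem_val x)) uv idem_valP.
have inG (y : idem_mod d) : idem_val y *m v \in @idem_fix B c.
  by rewrite unfold_in -uv mulmxA -(mulmxA (idem_val y)) vu idem_valP.
exists (fun x => IdemMod (inF x)); split.
  by move=> a x y; apply: idem_val_inj; rewrite /= mulmxDl -scalemxAl.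
exists (fun y => IdemMod (inG y)) => x; apply: idem_val_inj => /=.
  by rewrite -mulmxA uv idem_valP.
by rewrite -mulmxA vu idem_valP.
Qed.

(** A lift to [X] is determined by lifts of the images of the basis vectors. *)
Lemma mod_fgp_idem (M : lmodType B) (c : idem B) :
  mod_iso M (idem_mod c) -> mod_fgp M.
Proof.
move=> [F [linF [G FK GK]]].
have linG : linear G.
  by move=> a x y; apply: (can_inj FK); rewrite GK linF !GK.
have fixc (v : 'rV[B]_(idem_size c)) : v *m idem_mx c \in @idem_fix B c.
  by rewrite unfold_in -mulmxA idemP.
pose p v := G (IdemMod (fixc v)).
have p_lin : linear p.
  move=> a v w; rewrite /p -linG; congr (G _).
  by apply: idem_val_inj; rewrite /= mulmxDl -scalemxAl.
pose pL : {linear _ -> _} := HB.pack p (GRing.isLinear.Build _ _ _ _ p p_lin).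
have pF x : p (idem_val (F x)) = x.
  by rewrite /p -[RHS]FK; congr (G _); apply: idem_val_inj; rewrite /= idem_valP.
split; first by exists (idem_size c), pL => x; exists (idem_val (F x)); exact: pF.
move=> X Y g h gsurj.
have /choice[s hs] (i : 'I_(idem_size c)) : exists x, g x = h (p (delta_mx 0 i)).
  exact: gsurj.
pose k x := \sum_i idem_val (F x) 0 i *: s i.
have k_lin : linear k.
  move=> a x y; rewrite /k linF idem_val_linear scaler_sumr -big_split.
  by apply: eq_bigr => i _; rewrite !mxE scalerDl scalerA.
pose kL : {linear _ -> _} := HB.pack k (GRing.isLinear.Build _ _ _ _ k k_lin).
have pE v : p v = \sum_i v 0 i *: p (delta_mx 0 i).
  rewrite {1}[v]row_sum_delta -[LHS]/(pL _) linear_sum; apply: eq_bigr => i _.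
  by rewrite linearZ.
exists kL => x; rewrite /= /k linear_sum -[in RHS](pF x) pE linear_sum.
by apply: eq_bigr => i _; rewrite !linearZ /= hs.
Qed.

End IdemIso.

(** * Maps out of a Grothendieck group *)

Section GrothExt.
Variable V : nmodType.

Lemma groth_ofD (a b : V) : groth_of (a + b) = groth_of a + groth_of b.
Proof. by rewrite /groth_of [RHS]groth_addE addr0. Qed.

Lemma groth_piE (a b : V) : \pi_(groth V) (a, b) = groth_of a - groth_of b.
Proof. by rewrite /groth_of [- _]groth_oppE [RHS]groth_addE addr0 add0r. Qed.

Variables (H : zmodType) (f : V -> H).
Hypothesis fD : {morph f : a b / a + b}.

Definition groth_ext (x : groth V) : H := f (repr x).1 - f (repr x).2.

Lemma groth_ext_of a : groth_ext (groth_of a) = f a.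
Proof.
have f0 : f 0 = 0 by apply: (addrI (f 0)); rewrite -fD !addr0.
rewrite /groth_ext; set x := repr _.
have /eqP/groth_eqP[z /= e] : \pi_(groth V) x = \pi_(groth V) (a, 0) by rewrite reprK.
have := congr1 f e; rewrite !fD f0 addr0 => /addIr ->.
by rewrite addrK.
Qed.

Lemma groth_extD : {morph groth_ext : x y / x + y}.
Proof.
move=> x y.
rewrite /groth_ext; set xy := repr (x + y).
have /eqP/groth_eqP[z /= e] : \pi_(groth V) xy =
    \pi_(groth V) ((repr x).1 + (repr y).1, (repr x).2 + (repr y).2) by rewrite reprK.
have := congr1 f e; rewrite !fD => /addIr h.
by rewrite addrACA -opprD; apply/eqP; rewrite subr_eq [X in _ == X]addrAC eq_sym subr_eq h.
Qed.

End GrothExt.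

(** * Equivalence of idempotents in a given degree *)

Section GradedEquiv.
Variables (R : realType) (n : nat) (A : quantum_sphere R n).
Local Notation P := (@vproj R n A).
Local Notation S := (@eisom R n A).
Local Notation B := (cp_alg A).
Implicit Types (a b : A) (d : int).

Lemma deg_cp a : a \in @cp_pred R n A <-> deg 0 a.
Proof.
split=> [/cp_predP h z z1|h]; first by rewrite h // expr0z scale1r.
by apply/cp_predP => z z1; rewrite h // expr0z scale1r.
Qed.

Lemma deg_L d a : a \in @L_pred R n A d <-> deg d a.
Proof. by split=> [/L_predP|h] //; apply/L_predP. Qed.

Definition mdeg d m r (x : 'M[A]_(m, r)) := forall i j, deg d (x i j).

Lemma mdegM d d' m r s (x : 'M[A]_(m, r)) (y : 'M[A]_(r, s)) :
  mdeg d x -> mdeg d' y -> mdeg (d + d') (x *m y).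
Proof. by move=> hx hy i j; rewrite mxE; apply: deg_sum => k _; apply: degM. Qed.

Lemma mdeg0 d m r : mdeg d (0 : 'M[A]_(m, r)).
Proof. by move=> i j; rewrite mxE; apply: deg_0. Qed.

Lemma mdeg_block d m m' r r' (x : 'M[A]_(m, r)) (y : 'M[A]_(m', r')) :
  mdeg d x -> mdeg d y -> mdeg d (block_mx x 0 0 y).
Proof.
move=> hx hy i j; rewrite !mxE.
by case: splitP => k _; rewrite mxE; case: splitP => l _ //; rewrite mxE; exact: deg_0.
Qed.

Definition cpidem m (e : 'M[A]_m) := mdeg 0 e /\ e *m e = e.

(** Murray-von Neumann equivalence implemented by elements of degree [d]: for
    [d = 0] this is isomorphism of modules over the fixed point algebra, and an
    idempotent is equivalent to [1] in degree [d] when its module is [L_d]. *)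
Definition gequiv d m r (e : 'M[A]_m) (f : 'M[A]_r) :=
  exists (u : 'M[A]_(m, r)) (v : 'M[A]_(r, m)),
    [/\ mdeg d u, mdeg (- d) v, u *m v = e & v *m u = f].

Lemma gequiv_refl m (e : 'M[A]_m) : cpidem e -> gequiv 0 e e.
Proof. by case=> de ee; exists e, e; rewrite oppr0. Qed.

Lemma gequiv_sym d m r (e : 'M[A]_m) (f : 'M[A]_r) : gequiv d e f -> gequiv (- d) f e.
Proof. by case=> u [v [hu hv uv vu]]; exists v, u; rewrite opprK. Qed.

Lemma gequiv_trans d d' m r s (e : 'M[A]_m) (f : 'M[A]_r) (g : 'M[A]_s) :
  cpidem e -> cpidem g -> gequiv d e f -> gequiv d' f g -> gequiv (d + d') e g.
Proof.
move=> [_ ee] [_ gg] [u [v [hu hv uv vu]]] [u' [v' [hu' hv' uv' vu']]].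
exists (u *m u'), (v' *m v); split.
- exact: mdegM.
- by rewrite opprD addrC; apply: mdegM.
- by rewrite mulmxA -(mulmxA u) uv' -vu mulmxA uv -mulmxA uv ee.
- by rewrite mulmxA -(mulmxA v') vu -uv' mulmxA vu' -mulmxA vu' gg.
Qed.

Lemma gequiv_block d m m' r r' (e : 'M[A]_m) (e' : 'M[A]_m') (f : 'M[A]_r)
    (f' : 'M[A]_r') : gequiv d e f -> gequiv d e' f' ->
  gequiv d (block_mx e 0 0 e') (block_mx f 0 0 f').
Proof.
move=> [u [v [hu hv uv vu]]] [u' [v' [hu' hv' uv' vu']]].
exists (block_mx u 0 0 u'), (block_mx v 0 0 v'); split; try exact: mdeg_block.
  by rewrite mulmx_block !mulmx0 !mul0mx !addr0 !add0r uv uv'.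
by rewrite mulmx_block !mulmx0 !mul0mx !addr0 !add0r vu vu'.
Qed.

Lemma gequiv_orth m (e f : 'M[A]_m) : cpidem e -> cpidem f -> e *m f = 0 -> f *m e = 0 ->
  gequiv 0 (block_mx e 0 0 f) (e + f).
Proof.
move=> [de ee] [df ff] ef fe; exists (col_mx e f), (row_mx e f); split.
- by move=> i j; rewrite mxE; case: splitP.
- by rewrite oppr0 => i j; rewrite mxE; case: splitP.
- by rewrite mul_col_row ee ff ef fe.
- by rewrite mul_row_col ee ff.
Qed.

(** The matrices [u], [v] of an equivalence of nonzero degree do not lie over
    [B], so the idempotents over [B] are compared as matrices over [A]. *)
Definition ival (c : idem B) : 'M[A]_(idem_size c) := map_mx val (idem_mx c).

Lemma ival_cpidem c : cpidem (ival c).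
Proof.
split=> [i j|]; last by rewrite /ival -map_mxM idemP.
by rewrite mxE; apply/deg_cp; exact: cp_valP.
Qed.

Lemma mdeg_lift m r (x : 'M[A]_(m, r)) : mdeg 0 x ->
  exists x' : 'M[B]_(m, r), map_mx val x' = x.
Proof.
move=> hx; have hx' i j : x i j \in @cp_pred R n A by exact/deg_cp.
by exists (\matrix_(i, j) CPAlg (hx' i j)); apply/matrixP => i j; rewrite !mxE.
Qed.

Lemma map_val_inj m r : injective (fun x : 'M[B]_(m, r) => map_mx (val : B -> A) x).
Proof.
move=> x y /matrixP e; apply/matrixP => i j; apply: val_inj.
by have := e i j; rewrite !mxE.
Qed.

Lemma cpidem_code m (e : 'M[A]_m) : cpidem e -> exists c, gequiv 0 (ival c) e.
Proof.
move=> he; have [de ee] := he; have [e' ee'] := mdeg_lift de.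
have e'P : e' *m e' = e' by apply: map_val_inj; rewrite map_mxM ee'.
by exists (Idem e'P); rewrite /ival /= ee'; exact: gequiv_refl.
Qed.

Lemma gequiv0_iso (c d : idem B) :
  mod_iso (idem_mod c) (idem_mod d) <-> gequiv 0 (ival c) (ival d).
Proof.
split=> [/idem_isoP[u [v [uv vu]]]|[u [v [hu hv uv vu]]]].
  exists (map_mx val u), (map_mx val v); rewrite -!map_mxM uv vu; split=> //.
    by move=> i j; rewrite mxE; apply/deg_cp; exact: cp_valP.
  by rewrite oppr0 => i j; rewrite mxE; apply/deg_cp; exact: cp_valP.
have [u' eu] := mdeg_lift hu; rewrite oppr0 in hv; have [v' ev] := mdeg_lift hv.
apply/idem_isoP; exists u', v'; split; apply: map_val_inj; rewrite map_mxM eu ev.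
  exact: uv.
exact: vu.
Qed.

Definition cls (c : idem B) : K0 B := @groth_of (Vmon B) (\pi_(Vmon B) c).

Lemma cls_gequiv (c d : idem B) : gequiv 0 (ival c) (ival d) -> cls c = cls d.
Proof. by move=> /gequiv0_iso/Vmon_eqP/eqP e; rewrite /cls e. Qed.

Lemma cls_add (c d : idem B) : cls (idem_add c d) = cls c + cls d.
Proof. by rewrite /cls -groth_ofD; congr groth_of; rewrite [RHS]Vmon_addE. Qed.

Lemma ival_add (c d : idem B) : ival (idem_add c d) = block_mx (ival c) 0 0 (ival d).
Proof. by rewrite /ival [idem_mx (idem_add _ _)]/= map_block_mx !map_mx0. Qed.

Lemma K0_ind (H : K0 B -> Prop) : (forall x y, H x -> H y -> H (x - y)) ->
  (forall c, H (cls c)) -> forall x, H x.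
Proof.
move=> HB Hc; elim/groth_ind => a b; rewrite groth_piE.
by elim/Vmon_ind: a => c; elim/Vmon_ind: b => d; apply: HB; exact: Hc.
Qed.

(** * Line modules *)

(** The isomorphism is right multiplication by [v], and its inverse is right
    multiplication by [u]. *)
Lemma line_iso k (c : idem B) : gequiv k (ival c) (1%:M : 'M[A]_1) ->
  mod_iso (line_mod A k) (idem_mod c).
Proof.
move=> [u [v [hu hv uv vu]]].
have inB (a : line_mod A k) j : line_val a * v 0 j \in @cp_pred R n A.
  apply/deg_cp; rewrite -(subrr k); apply: degM; last exact: hv.
  exact/deg_L/line_valP.
pose row_of (l : line_mod A k) : 'rV[B]_(idem_size c) := \row_j CPAlg (inB l j).
have row_ofE l : map_mx val (row_of l) = (line_val l)%:M *m v.
  by apply/matrixP => i j; rewrite ord1 mul_scalar_mx !mxE.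
have inF l : row_of l \in @idem_fix B c.
  rewrite unfold_in; apply/eqP/map_val_inj; rewrite map_mxM row_ofE.
  by rewrite -/(ival c) -uv mulmxA -(mulmxA _ v) vu mulmx1.
have inL (x : idem_mod c) :
    (map_mx val (idem_val x) *m u) 0 0 \in @L_pred R n A k.
  apply/deg_L; rewrite mxE; apply: deg_sum => i _; rewrite -(add0r k).
  by apply: degM; [rewrite mxE; apply/deg_cp; exact: cp_valP | exact: hu].
exists (fun l => IdemMod (inF l)); split.
  move=> b x y; apply: idem_val_inj; apply/matrixP => i j; apply: val_inj.
  by rewrite !mxE /= mulrDl mulrA.
exists (fun x => LineMod (inL x)) => [a|x].
  apply: val_inj; rewrite /= row_ofE -mulmxA vu mulmx1 mxE eqxx.
  by [].
apply: idem_val_inj; apply: map_val_inj; rewrite /= row_ofE /=.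
have -> : ((map_mx val (idem_val x) *m u) 0 0)%:M = map_mx val (idem_val x) *m u.
  by rewrite -mx11_scalar.
by rewrite -mulmxA uv -map_mxM idem_valP.
Qed.

(** * The shift *)

Definition loop (v : 'I_n.+1) : edge n := exist _ (v, v) (leqnn v).

(** Conjugation by this isometry is an endomorphism of the fixed point algebra,
    which does not preserve the unit; on [K0] it shifts the line modules. *)
Definition Uiso : A := \sum_v S (loop v).

Lemma Uiso_deg : deg 1 Uiso.
Proof. by apply: deg_sum => v _; exact: deg_eisom. Qed.

Lemma Uiso_isom : star Uiso * Uiso = 1.
Proof.
rewrite /Uiso star_sum mulr_suml -vproj_sum; apply: eq_bigr => v _.
rewrite mulr_sumr (bigD1 v) //= eisom_orth eqxx big1 ?addr0 // => w wv.
by rewrite eisom_orth; case: eqP => // -[vw]; rewrite vw eqxx in wv.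
Qed.

Lemma shift_inP (b : B) : Uiso * cp_val b * star Uiso \in @cp_pred R n A.
Proof.
apply/deg_cp; rewrite -(subrr 1); apply: degM; last exact/deg_star/Uiso_deg.
by rewrite -[1]addr0; apply: degM Uiso_deg _; apply/deg_cp/cp_valP.
Qed.
Definition shiftB (b : B) : B := CPAlg (shift_inP b).

Lemma shiftBD : {morph shiftB : x y / x + y}.
Proof. by move=> x y; apply: val_inj; rewrite /= mulrDr mulrDl. Qed.

Lemma shiftB0 : shiftB 0 = 0.
Proof. by apply: val_inj; rewrite /= mulr0 mul0r. Qed.

Lemma shiftBM : {morph shiftB : x y / x * y}.
Proof.
move=> x y; apply: val_inj; rewrite /=.
have -> : Uiso * cp_val x * star Uiso * (Uiso * cp_val y * star Uiso) =
  Uiso * cp_val x * (star Uiso * Uiso) * cp_val y * star Uiso by ncring.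
by rewrite Uiso_isom mulr1 !mulrA.
Qed.

Lemma shift_idemP (c : idem B) :
  map_mx shiftB (idem_mx c) *m map_mx shiftB (idem_mx c) = map_mx shiftB (idem_mx c).
Proof.
rewrite -{3}(idemP c); apply/matrixP => i j; rewrite !mxE.
rewrite (big_morph shiftB shiftBD shiftB0); apply: eq_bigr => k _.
by rewrite !mxE shiftBM.
Qed.
Definition shift_idem (c : idem B) : idem B := Idem (shift_idemP c).

(** For [e = ival c], the equivalence is given by [U e] and [e U^*]. *)
Lemma gequiv_shift c : gequiv 1 (ival (shift_idem c)) (ival c).
Proof.
have [dc cc] := ival_cpidem c.
exists (map_mx (fun a => Uiso * a) (ival c)), (map_mx (fun a => a * star Uiso) (ival c)).
split.
- by move=> i j; rewrite mxE -[1]addr0; apply: degM Uiso_deg _; apply: dc.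
- by move=> i j; rewrite mxE -[- 1]add0r; apply: degM (deg_star Uiso_deg); apply: dc.
- apply/matrixP => i j; rewrite [RHS]mxE [in RHS]mxE /=.
  have -> : cp_val (idem_mx c i j) = (ival c *m ival c) i j by rewrite cc mxE.
  rewrite !mxE mulr_sumr mulr_suml; apply: eq_bigr => k _; rewrite !mxE.
  by rewrite !mulrA.
rewrite -[RHS]cc; apply/matrixP => i j; rewrite !mxE; apply: eq_bigr => k _.
by rewrite !mxE -!mulrA (mulrA (star _)) Uiso_isom mul1r.
Qed.

Lemma gequiv_shift_iso (c d : idem B) : gequiv 0 (ival c) (ival d) ->
  gequiv 0 (ival (shift_idem c)) (ival (shift_idem d)).
Proof.
move=> cd; rewrite -(subrr 1); apply: gequiv_trans (gequiv_sym (gequiv_shift d)).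
- exact: ival_cpidem.
- exact: ival_cpidem.
rewrite -[1]addr0; apply: gequiv_trans (gequiv_shift c) cd; exact: ival_cpidem.
Qed.

Definition shiftV (x : Vmon B) : K0 B := cls (shift_idem (repr x)).

Lemma shiftVE c : shiftV (\pi c) = cls (shift_idem c).
Proof.
apply: cls_gequiv; apply: gequiv_shift_iso; apply/gequiv0_iso/Vmon_eqP.
by rewrite reprK.
Qed.

Lemma shiftVD : {morph shiftV : x y / x + y}.
Proof.
elim/Vmon_ind => c; elim/Vmon_ind => d.
have -> : (\pi_(Vmon B) c : Vmon B) + (\pi_(Vmon B) d : Vmon B) =
    \pi_(Vmon B) (idem_add c d).
  exact: Vmon_addE.
rewrite !shiftVE -cls_add; apply: cls_gequiv.
have e : idem_mx (shift_idem (idem_add c d)) =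
    idem_mx (idem_add (shift_idem c) (shift_idem d)).
  rewrite /= map_block_mx.
  by congr (block_mx _ _ _ _); apply/matrixP => i j; rewrite !mxE shiftB0.
have -> : ival (shift_idem (idem_add c d)) = ival (idem_add (shift_idem c) (shift_idem d)).
  by congr (map_mx _ _); exact: e.
exact: (gequiv_refl (ival_cpidem (idem_add (shift_idem c) (shift_idem d)))).
Qed.

Definition K0shift : K0 B -> K0 B := groth_ext shiftV.

Lemma K0shiftD : {morph K0shift : x y / x + y}.
Proof. exact: groth_extD shiftVD. Qed.

Lemma K0shift_cls c : K0shift (cls c) = cls (shift_idem c).
Proof. by rewrite /K0shift groth_ext_of ?shiftVE //; exact: shiftVD. Qed.

End GradedEquiv.

(** * Idempotent matrices of degree zero *)

Section Generation.
Variables (R : realType) (n : nat) (A : quantum_sphere R n).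
Local Notation P := (@vproj R n A).
Local Notation S := (@eisom R n A).
Local Notation B := (cp_alg A).
Local Notation nrmA := (@nrm R A).
Let nB := nrm_banach A.

Lemma cpidem_scalar r (a : A) : deg 0 a -> a * a = a -> cpidem (a%:M : 'M[A]_r).
Proof.
move=> da aa; split; last by rewrite -scalar_mxM aa.
by move=> i j; rewrite mxE; case: eqP => _ //; exact: deg_0.
Qed.

Lemma cpidem_id r : cpidem (1%:M : 'M[A]_r).
Proof. by apply: cpidem_scalar; [exact: deg1 | rewrite mulr1]. Qed.

Lemma cpidem0 r : cpidem (0 : 'M[A]_r).
Proof. by split; [exact: mdeg0 | rewrite mulmx0]. Qed.

Lemma cpidemD m (e f : 'M[A]_m) : cpidem e -> cpidem f -> e *m f = 0 -> f *m e = 0 ->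
  cpidem (e + f).
Proof.
move=> [de ee] [df ff] ef fe; split; first by move=> i j; rewrite mxE; apply: degD.
by rewrite mulmxDl !mulmxDr ee ff ef fe addr0 add0r.
Qed.

(** * Cutting matrices along the edges *)

(** The row of all the [S_e], tensored with the identity matrix of size [m]:
    columns are indexed by pairs of a row index and an edge. *)
Definition edge_row m : 'M[A]_(m, #|{: 'I_m * edge n}|) :=
  \matrix_(i, c) if i == (enum_val c).1 then S (enum_val c).2 else 0.
Definition edge_col m : 'M[A]_(#|{: 'I_m * edge n}|, m) :=
  \matrix_(c, i) if i == (enum_val c).1 then star (S (enum_val c).2) else 0.

Lemma edge_row_col m : edge_row m *m edge_col m = 1%:M.
Proof.
apply/matrixP => i j; rewrite !mxE.
under eq_bigr do rewrite !mxE.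
rewrite -(big_enum_val (fun p : 'I_m * edge n =>
  (if i == p.1 then S p.2 else 0) * (if j == p.1 then star (S p.2) else 0))).
rewrite (eq_bigl predT) //.
rewrite -(pair_bigA _ (fun k e =>
  (if i == k then S e else 0) * (if j == k then star (S e) else 0))) /=.
rewrite (bigD1 i) //= [X in _ + X]big1 => [|k ki]; last first.
  by rewrite big1 // => e _; rewrite eq_sym (negPf ki) mul0r.
rewrite addr0 eqxx; case: (eqVneq i j) => _; first exact: eisom_sum.
by rewrite big1 // => e _; rewrite mulr0.
Qed.

Lemma edge_row_deg m : mdeg 1 (edge_row m).
Proof. by move=> i c; rewrite mxE; case: eqP => _; [exact: deg_eisom | exact: deg_0]. Qed.

Lemma edge_col_deg m : mdeg (- 1) (edge_col m).
Proof.
move=> i c; rewrite mxE.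
by case: eqP => _; [exact: deg_star_eisom | exact: deg_0].
Qed.

(** Conjugating by [edge_row] strips an edge from both sides of an
    [S_mu S_nu^*], and it is an equivalence of degree one because
    [sum_e S_e S_e^* = 1]. *)
Definition edge_cut {m} (e : 'M[A]_m) := edge_col m *m e *m edge_row m.

Lemma edge_cut_gequiv m (e : 'M[A]_m) : cpidem e -> gequiv 1 e (edge_cut e).
Proof.
move=> [de ee]; exists (e *m edge_row m), (edge_col m *m e); split.
- by rewrite -[1]add0r; apply: mdegM => //; exact: edge_row_deg.
- by rewrite -[- 1]addr0; apply: mdegM => //; exact: edge_col_deg.
- by rewrite -mulmxA (mulmxA (edge_row m)) edge_row_col mul1mx ee.
- by rewrite mulmxA -(mulmxA _ e e) ee.
Qed.

Lemma edge_cut_cpidem m (e : 'M[A]_m) : cpidem e -> cpidem (edge_cut e).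
Proof.
move=> [de ee]; split.
  rewrite -(addNr 1); apply: mdegM; last exact: edge_row_deg.
  by rewrite -[- 1]addr0; apply: mdegM => //; exact: edge_col_deg.
rewrite /edge_cut -!mulmxA (mulmxA (edge_row m)) edge_row_col mul1mx.
by rewrite (mulmxA e) ee.
Qed.

Lemma edge_cut_core m k (e : 'M[A]_m) : (forall i j, core k.+1 k.+1 (e i j)) ->
  forall c d, core k k (edge_cut e c d).
Proof.
move=> he c d; rewrite mxE; apply: core_sum => j _; rewrite !mxE.
case: eqP => _; last by rewrite mulr0; exact: core_0.
rewrite mulr_suml; apply: core_sum => i _; rewrite !mxE.
case: eqP => _; last by rewrite !mul0r; exact: core_0.
have h : core k k.+1 (star (S (enum_val c).2) * e i j) by exact: he.
by move/core_r: h; apply.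
Qed.

(** * Generation of the group by the shift *)

Section Subgroup.
Variable H : K0 B -> Prop.
Hypothesis HB : forall x y, H x -> H y -> H (x - y).
Hypothesis Hs : forall x, H x -> H (K0shift x).
Hypothesis H1 : forall c, gequiv 0 (ival c) (1%:M : 'M[A]_1) -> H (cls c).

(** A matrix over [A] has no class of its own; its class is the one of any
    equivalent idempotent over [B]. *)
Definition inH m (e : 'M[A]_m) := exists2 c, gequiv 0 (ival c) e & H (cls c).

Let H0 : H 0.
Proof.
have [c hc] := cpidem_code (cpidem_id 1).
by rewrite -(subrr (cls c)); apply: HB; exact: H1.
Qed.

Let HD x y : H x -> H y -> H (x + y).
Proof. by move=> hx hy; rewrite -[y]opprK -[- y]sub0r; apply/HB/HB. Qed.

Lemma inH_gequiv m r (e : 'M[A]_m) (f : 'M[A]_r) :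
  cpidem f -> inH e -> gequiv 0 e f -> inH f.
Proof.
move=> gf [c ce Hc] ef; exists c => //; rewrite -[0]addr0.
by apply: gequiv_trans ef => //; exact: ival_cpidem.
Qed.

Lemma inH_shift m r (e : 'M[A]_m) (f : 'M[A]_r) : cpidem e -> cpidem f ->
  gequiv 1 f e -> inH e -> inH f.
Proof.
move=> ge gf fe [c ce Hc]; exists (shift_idem c); last by rewrite -K0shift_cls; apply: Hs.
rewrite -(subrr 1); apply: (gequiv_trans (f := e)) => //; first exact: ival_cpidem.
  rewrite -[1]addr0; apply: gequiv_trans (gequiv_shift c) ce => //; exact: ival_cpidem.
exact: gequiv_sym.
Qed.

Lemma inH_block m r (e : 'M[A]_m) (f : 'M[A]_r) : inH e -> inH f ->
  inH (block_mx e 0 0 f).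
Proof.
move=> [c ce Hc] [d df Hd]; exists (idem_add c d); last by rewrite cls_add; apply: HD.
by rewrite ival_add; exact: gequiv_block.
Qed.

Lemma inH_add m (e f : 'M[A]_m) : cpidem e -> cpidem f -> e *m f = 0 -> f *m e = 0 ->
  inH e -> inH f -> inH (e + f).
Proof.
move=> ge gf ef fe he hf; apply: (inH_gequiv _ (inH_block he hf)).
  exact: cpidemD.
exact: gequiv_orth.
Qed.

Lemma inH_sub m (e f : 'M[A]_m) : cpidem e -> cpidem f -> e *m f = 0 -> f *m e = 0 ->
  inH (e + f) -> inH e -> inH f.
Proof.
move=> ge gf ef fe [c hc Hc] [d hd Hd]; have [d' hd'] := cpidem_code gf.
exists d' => //; have -> : cls d' = cls c - cls d.
  apply/eqP; rewrite eq_sym subr_eq -[X in _ == X]addrC -cls_add; apply/eqP/cls_gequiv.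
  have hef := gequiv_orth ge gf ef fe.
  rewrite -[0](subrr 0); apply: (gequiv_trans (f := e + f)) => //; try exact: ival_cpidem.
  apply: gequiv_sym; rewrite -[0]addr0; apply: gequiv_trans hef.
  - exact: ival_cpidem.
  - exact: cpidemD.
  by rewrite ival_add; exact: gequiv_block.
exact: HB.
Qed.

Lemma inH0 m : inH (0 : 'M[A]_m).
Proof.
exists (idem0 B); last exact: H0.
exists 0, 0; split; rewrite ?mulmx0 ?mul0mx //; try exact: mdeg0.
by apply/matrixP => i j; case: i.
Qed.

Lemma inH_sum (I : eqType) (s : seq I) m (e : I -> 'M[A]_m) : uniq s ->
  (forall i, cpidem (e i)) -> (forall i j, i != j -> e i *m e j = 0) ->
  (forall i, inH (e i)) ->
  inH (\sum_(i <- s) e i) /\ cpidem (\sum_(i <- s) e i).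
Proof.
move=> us ge oe he; elim: s us => [_|i s IH /andP[iNs /IH[h g]]].
  by rewrite big_nil; split; [exact: inH0 | exact: cpidem0].
have o1 : e i *m (\sum_(j <- s) e j) = 0.
  rewrite mulmx_sumr big_seq big1 // => j js; apply: oe.
  by apply: contraNneq iNs => ->.
have o2 : (\sum_(j <- s) e j) *m e i = 0.
  rewrite mulmx_suml big_seq big1 // => j js; apply: oe.
  by apply: contraNneq iNs => <-.
by rewrite big_cons; split; [exact: inH_add | exact: cpidemD].
Qed.

Definition tail (i : nat) : A := \sum_(v : 'I_n.+1 | (i <= v)%N) P v.

Lemma tail_deg i : deg 0 (tail i).
Proof. by apply: deg_sum => v _; exact: deg_vproj. Qed.

Lemma vproj_tail v i : P v * tail i = if (i <= v)%N then P v else 0.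
Proof.
rewrite /tail mulr_sumr; case: ifP => iv.
  rewrite (bigD1 v) //= vproj_sqr big1 ?addr0 // => w /andP[_ wv].
  by rewrite vproj_mul eq_sym (negPf wv).
rewrite big1 // => w iw; rewrite vproj_mul; case: eqP => // vw.
by rewrite vw iw in iv.
Qed.

Lemma tail_vproj v i : tail i * P v = if (i <= v)%N then P v else 0.
Proof.
rewrite /tail mulr_suml; case: ifP => iv.
  rewrite (bigD1 v) //= vproj_sqr big1 ?addr0 // => w /andP[_ wv].
  by rewrite vproj_mul (negPf wv).
rewrite big1 // => w iw; rewrite vproj_mul; case: eqP => // vw.
by rewrite -vw iw in iv.
Qed.

Lemma tail_idem i : tail i * tail i = tail i.
Proof. by rewrite {1}/tail mulr_suml; apply: eq_bigr => v iv; rewrite vproj_tail iv. Qed.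

Lemma tailS (v : 'I_n.+1) : tail v = P v + tail v.+1.
Proof.
rewrite /tail (bigD1 v) //=; congr (_ + _); apply: eq_bigl => w.
by rewrite ltn_neqAle andbC eq_sym.
Qed.

(** The sum [u] of the edges leaving [v] satisfies [u u^* = P v], because these
    edges have distinct targets, and [u^* u = tail v], because there is exactly
    one of them for each target [w >= v]. *)
Lemma vproj_gequiv_tail (v : 'I_n.+1) :
  gequiv 1 ((P v)%:M : 'M[A]_1) ((tail v)%:M : 'M[A]_1).
Proof.
pose u := \sum_(e | esrc e == v) S e.
have edge_eq (e f : edge n) : esrc e = esrc f -> etgt e = etgt f -> e = f.
  case: e f => [[i j] ij] [[i' j'] ij']; rewrite /esrc /etgt /= => ei ej.
  by apply: val_inj; rewrite /= ei ej.
have uu : u * star u = P v.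
  rewrite -(ck_src (univ_ck (qs_univ A))) star_sum mulr_suml; apply: eq_bigr => e /eqP ev.
  rewrite mulr_sumr (bigD1 e) ?ev //= big1 ?addr0 // => f /andP[/eqP fv fe].
  have := vproj_star_eisom A (etgt e) f; rewrite -[S e]eisom_tgt -mulrA => ->.
  case: eqP => [tf|_]; last by rewrite mulr0.
  by rewrite (edge_eq f e) ?eqxx ?fv ?ev // in fe.
have us : star u * u = tail v.
  rewrite star_sum mulr_suml (eq_bigr (fun e => P (etgt e))) => [|e /eqP ev].
    rewrite /tail (reindex_onto (@etgt n) (fun w => insubd (loop v) (v, w))) /=.
      apply: eq_bigl => e; apply/idP/andP => [/eqP ev|[ve /eqP h]].
        split; first by rewrite -ev /esrc /etgt; exact: (valP e).
        apply/eqP/edge_eq; rewrite /esrc /etgt insubdK //= ?ev // -topredE /= -ev;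
          exact: (valP e).
      by rewrite -h /esrc insubdK.
    by move=> w vw; rewrite /etgt insubdK.
  rewrite mulr_sumr (bigD1 e) ?ev //= eisom_orth eqxx big1 ?addr0 // => f /andP[_ fe].
  by rewrite eisom_orth eq_sym (negPf fe).
have du : deg 1 u by apply: deg_sum => e _; exact: deg_eisom.
exists u%:M, (star u)%:M; split.
- by move=> i j; rewrite !ord1 mxE eqxx.
- by move=> i j; rewrite !ord1 mxE eqxx; exact: deg_star.
- by rewrite -scalar_mxM uu.
- by rewrite -scalar_mxM us.
Qed.

Lemma cpidem_tail i : cpidem ((tail i)%:M : 'M[A]_1).
Proof. by apply: cpidem_scalar; [exact: tail_deg | exact: tail_idem]. Qed.

Lemma cpidem_vproj v r : cpidem ((P v)%:M : 'M[A]_r).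
Proof. by apply: cpidem_scalar; [exact: deg_vproj | exact: vproj_sqr]. Qed.

(** The class of [P_i] is the shift of the class of [tail i], and the class of
    [tail (i + 1)] is the difference of the two. *)
Lemma inH_tail i : inH ((tail i)%:M : 'M[A]_1).
Proof.
elim: i => [|i IH].
  have -> : tail 0 = 1 by rewrite -vproj_sum /tail; apply: eq_bigl.
  have [c hc] := cpidem_code (cpidem_id 1); exists c => //; exact: H1.
have [ni|ni] := ltnP n i.
  have -> : tail i.+1 = 0.
    by rewrite /tail big1 // => v iv; have := ltn_ord v; lia.
  by rewrite raddf0; exact: inH0.
pose v : 'I_n.+1 := @Ordinal n.+1 i ni.
have iv : i = v by [].
have gv := cpidem_vproj v 1.
have hv : inH ((P v)%:M : 'M[A]_1).
  by apply: (inH_shift _ gv (vproj_gequiv_tail v)); [exact: cpidem_tail | rewrite -iv].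
apply: (inH_sub gv (cpidem_tail _)) hv.
- by rewrite -scalar_mxM vproj_tail iv ltnn raddf0.
- by rewrite -scalar_mxM tail_vproj iv ltnn raddf0.
- by rewrite -raddfD /= iv -tailS -iv.
Qed.

Lemma inH_vproj v : inH ((P v)%:M : 'M[A]_1).
Proof.
apply: (inH_shift _ (cpidem_vproj v 1) (vproj_gequiv_tail v) (inH_tail v)).
exact: cpidem_tail.
Qed.

Lemma inH_vprojM v r : inH ((P v)%:M : 'M[A]_r).
Proof.
elim: r => [|r IH]; first by rewrite [X in inH X]flatmx0; exact: inH0.
by have := inH_block (inH_vproj v) IH; rewrite -scalar_mx_block.
Qed.

(** A complex idempotent of rank [r] factors as [C D] with [D C = 1], so it is
    equivalent to the identity matrix of size [r]. *)
Lemma inH_complex v m (M : 'M[R[i]]_m) : M *m M = M ->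
  inH (map_mx (fun c => c *: P v) M).
Proof.
have := mulmx_base M; have := row_base_free M; have := col_base_full M.
set C := col_base M; set D := row_base M => Cfull Dfree CD MM.
have DC : D *m C = 1%:M.
  apply: (row_full_inj Cfull); apply: (row_free_inj Dfree).
  by rewrite mulmx1 mulmxA CD -mulmxA CD MM.
have mapM p q r (X : 'M[R[i]]_(p, q)) (Y : 'M[R[i]]_(q, r)) :
    map_mx (fun c => c *: P v) X *m map_mx (fun c => c *: P v) Y =
    map_mx (fun c => c *: P v) (X *m Y).
  apply/matrixP => i j; rewrite !mxE scaler_suml; apply: eq_bigr => k _.
  by rewrite !mxE -scalerAl -scalerAr vproj_sqr scalerA.
have dM p q (X : 'M[R[i]]_(p, q)) : mdeg 0 (map_mx (fun c => c *: P v) X).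
  by move=> i j; rewrite mxE; apply/degZ/deg_vproj.
apply: (inH_gequiv _ (inH_vprojM v (\rank M))); first by split; rewrite // mapM MM.
exists (map_mx (fun c => c *: P v) D), (map_mx (fun c => c *: P v) C).
rewrite oppr0 !mapM CD DC; split=> //; apply/matrixP => i j; rewrite !mxE.
by case: eqP => _; rewrite ?scale1r ?scale0r.
Qed.

Lemma inH_core0 m (e : 'M[A]_m) : cpidem e -> (forall i j, vspan (e i j)) -> inH e.
Proof.
move=> [de ee] he.
have /choice[c hc] (p : 'I_m * 'I_m * 'I_n.+1) :
    exists c, P p.2 * e p.1.1 p.1.2 = c *: P p.2 by exact: he.
(* When [P v] vanishes its coefficients are arbitrary; zero keeps [M v]
   idempotent. *)
pose M v : 'M[R[i]]_m := \matrix_(i, j) if P v == 0 then 0 else c (i, j, v).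
have hM v i j : P v * e i j = M v i j *: P v.
  rewrite mxE (hc (i, j, v)) /=; case: eqP => // ->.
  by rewrite !scaler0.
have MM v : M v *m M v = M v.
  have [v0|v0] := eqVneq (P v) 0.
    by apply/matrixP => i j; rewrite !mxE v0 eqxx big1 // => k _;
      rewrite !mxE v0 eqxx mul0r.
  apply/matrixP => i j; apply/eqP; rewrite -subr_eq0.
  have : (((M v *m M v) i j - M v i j) *: P v == 0).
    rewrite scalerBl -hM -[in e i j]ee !mxE scaler_suml mulr_sumr subr_eq0.
    apply/eqP; apply: eq_bigr => k _.
    by rewrite mulrA hM -scalerAl hM scalerA.
  by rewrite scaler_eq0 (negPf v0) orbF.
have -> : e = \sum_v map_mx (fun c => c *: P v) (M v).
  apply/matrixP => i j; rewrite summxE -[LHS]mul1r -vproj_sum mulr_suml.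
  by apply: eq_bigr => v _; rewrite [RHS]mxE hM.
apply: (proj1 (inH_sum (index_enum_uniq _) _ _ _)) => [v|v w vw|v].
- split; first by move=> i j; rewrite mxE; apply/degZ/deg_vproj.
  rewrite -[in RHS](MM v); apply/matrixP => i j; rewrite !mxE scaler_suml.
  by apply: eq_bigr => k _; rewrite !mxE -scalerAl -scalerAr vproj_sqr scalerA.
- apply/matrixP => i j; rewrite !mxE big1 // => k _.
  by rewrite !mxE -scalerAl -scalerAr vproj_mul (negPf vw) !scaler0.
- exact: inH_complex.
Qed.

(** Every cut along the edges lowers [k] by one and costs one shift. *)
Lemma inH_core k m (e : 'M[A]_m) : cpidem e -> (forall i j, core k k (e i j)) -> inH e.
Proof.
elim: k m e => [|k IH] m e ge he; first exact: inH_core0.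
apply: (inH_shift (edge_cut_cpidem ge) ge (edge_cut_gequiv ge)).
by apply: IH; [exact: edge_cut_cpidem | exact: edge_cut_core].
Qed.

Lemma norm_closed_mx m (X : A -> Prop) : norm_closed nrmA X ->
  norm_closed (@mxN R _ nrmA m) (fun x : 'M[A]_m => forall i j, X (x i j)).
Proof.
move=> clX t ht i j; apply: clX => r /ht[u Xu hu]; exists (u i j) => //.
by apply: le_lt_trans hu; have := mxN_entry nB (t - u) i j; rewrite !mxE.
Qed.

(** The approximation of the entries by [core_dense] is turned into an equivalent
    idempotent by [banach_idem_approx], applied in the algebra of matrices. *)
Lemma inH_cpidem m (e : 'M[A]_m) : cpidem e -> inH e.
Proof.
move=> ge; have [de ee] := ge; have mB := mxN_banach nB m.
have [||||r r0 hr] := @banach_idem_approx R _ _ mB (fun x => mdeg 0 x) e ee.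
- split; [exact: mdeg0 | | by move=> x y hx hy; rewrite -[0]addr0; exact: mdegM].
  by move=> x y hx hy i j; rewrite !mxE; apply: degB; [exact: hx | exact: hy].
- exact: (proj1 (cpidem_id m)).
- exact: (@norm_closed_mx m (@deg R n A 0) (@deg_closed R n A 0)).
- exact: de.
have [d d0 hd] := @mxN_small R _ nrmA m r r0.
have /choice[ka hka] (p : 'I_m * 'I_m) : exists kx : nat * A,
    core kx.1 kx.1 kx.2 /\ nrm (e p.1 p.2 - kx.2) < d.
  by have [k [x h]] := core_dense (de p.1 p.2) d0; exists (k, x).
pose k := \max_p (ka p).1.
pose a : 'M[A]_m := \matrix_(i, j) (ka (i, j)).2.
have ha i j : core k k (a i j).
  rewrite mxE; have [h _] := hka (i, j).
  have le : ((ka (i, j)).1 <= k)%N by exact: (leq_bigmax (i, j)).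
  by rewrite -(subnKC le); apply: core_add.
have [||||f [x [y [Wf ff [hx hy] xy yx]]]] :=
  hr (fun x => forall i j, core k k (x i j)) a _ _ _ ha.
- split; first by move=> i j; rewrite mxE; exact: core_0.
    by move=> x y hx hy i j; rewrite !mxE; apply: coreB; [exact: hx | exact: hy].
  move=> x y hx hy i j; rewrite mxE; apply: core_sum => l _.
  by apply: coreM; [exact: hx | exact: hy].
- exact: (@norm_closed_mx m (@core R n A k k) (@core_closed R n A k k)).
- by move=> x hx i j; rewrite -(subrr k%:Z); exact: core_deg.
- rewrite (bnC mB); apply: hd => i j; rewrite !mxE; exact: (hka (i, j)).2.
have gf : cpidem f by split=> // i j; rewrite -(subrr k%:Z); exact: core_deg.
apply: (inH_gequiv ge (inH_core gf Wf)); rewrite -[0]oppr0; apply: gequiv_sym.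
by exists x, y; rewrite oppr0.
Qed.

Lemma K0_generated x : H x.
Proof.
apply: (K0_ind HB) => c; have [d dc Hd] := inH_cpidem (ival_cpidem c).
by rewrite -(cls_gequiv dc).
Qed.

End Subgroup.
End Generation.

(** * The ring structure *)

Section CyclicRing.
Variables (G : zmodType) (s : G -> G) (L : int -> G).
Hypothesis sD : {morph s : x y / x + y}.
Hypothesis sL : forall k, s (L k) = L (k + 1).
Hypothesis genL : forall H : G -> Prop, (forall x y, H x -> H y -> H (x - y)) ->
  (forall x, H x -> H (s x)) -> H (L 0) -> forall x, H x.

Let s_linear (f : G -> G) := {morph f : x y / x - y} /\ forall x, f (s x) = s (f x).

Let sB x y : s (x - y) = s x - s y.
Proof. by apply: (addIr (s y)); rewrite -sD !subrK. Qed.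

Let s_linear_uniq f f' : s_linear f -> s_linear f' -> f (L 0) = f' (L 0) -> f =1 f'.
Proof.
move=> [fB fs] [fB' fs'] e; apply: genL => //.
  by move=> x y hx hy; rewrite fB fB' hx hy.
by move=> x hx; rewrite fs fs' hx.
Qed.

Let s_linear_ex x : exists2 f, s_linear f & f (L 0) = x.
Proof.
move: x; apply: genL => [x y [f [fB fs] <-] [f' [fB' fs'] <-]|x [f [fB fs] <-]|].
- exists (fun z => f z - f' z) => //; split=> [a b|a].
    by rewrite fB fB' !opprB addrACA [RHS]addrACA [- f b + _]addrC.
  by rewrite fs fs' sB.
- by exists (s \o f) => //; split=> [a b|a] /=; rewrite ?fB ?fs ?sB.
- by exists id.
Qed.

Let s_linear_comp f f' : s_linear f -> s_linear f' -> s_linear (f \o f').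
Proof. by move=> [fB fs] [fB' fs']; split=> [x y|x] /=; rewrite ?fB' ?fB ?fs' ?fs. Qed.

Let s_linear_iter m : s_linear (iter m s).
Proof.
elim: m => [|m [hB hs]]; first by [].
by split=> [x y|x]; rewrite !iterS ?hB ?sB ?hs.
Qed.

Let iter_L m k : iter m s (L k) = L (k + m%:Z).
Proof.
elim: m => [|m IH]; first by rewrite addr0.
by rewrite iterS IH sL; congr L; lia.
Qed.

(** An abelian group that is cyclic as a module over [Z[s]] is a quotient of
    [Z[s]] by an ideal: its elements are the endomorphisms commuting with [s],
    evaluated at the generator. *)
Lemma cyclic_ring : exists mul : G -> G -> G,
  is_ring_structure mul (L 0) /\ forall j k, mul (L j) (L k) = L (j + k).
Proof.
have /choice[F hF] (x : G) : exists f, s_linear f /\ f (L 0) = x.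
  by have [f cf fx] := s_linear_ex x; exists f.
have FD x a b : F x (a + b) = F x a + F x b.
  by have [[fB _] _] := hF x; have := fB (a + b) b; rewrite addrK => ->; rewrite subrK.
exists F; split; first split.
- move=> x y z; have [cx ex] := hF x; have [cy ey] := hF y.
  have [cxy exy] := hF (F x y).
  by apply: (s_linear_uniq (s_linear_comp cx cy) cxy); rewrite /= ey exy.
- by move=> x; have [c e] := hF (L 0); apply: (s_linear_uniq (f' := id)).
- by move=> x; have [] := hF x.
- move=> x y z; have [[Bx sx] ex] := hF x; have [[By sy] ey] := hF y.
  have [c e] := hF (x + y).
  apply: (s_linear_uniq (f' := fun z => F x z + F y z) c); last by rewrite ex ey.
  by split=> [a b|a]; rewrite ?Bx ?By ?sx ?sy ?sD // opprD addrACA.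
- by move=> x y z; exact: FD.
move=> j k; have [c e] := hF (L j).
case: j c e => m c e.
  have -> : F (L m) (L k) = iter m s (L k).
    by apply: (s_linear_uniq c (s_linear_iter m)); rewrite e iter_L add0r.
  by rewrite iter_L addrC.
(* Multiplication by [L (- (m + 1))] inverts the power [m + 1] of [s]. *)
have inv : F (L (Negz m)) \o iter m.+1 s =1 id.
  apply: (s_linear_uniq (s_linear_comp c (s_linear_iter _))) => //.
  rewrite /= -[s (iter m s _)]/(iter m.+1 s (L 0)) iter_L.
  have comm y : F (L (Negz m)) (iter m.+1 s y) = iter m.+1 s (F (L (Negz m)) y).
    by elim: (m.+1) => // l IH; rewrite !iterS (proj2 c) IH.
  by rewrite -iter_L comm e iter_L; congr L; lia.
have -> : L k = iter m.+1 s (L (k - m.+1%:Z)) by rewrite iter_L subrK.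
by rewrite -[LHS]/((F (L (Negz m)) \o iter m.+1 s) _) inv; congr L; lia.
Qed.

End CyclicRing.

(** The shift raises the degree by one, and cutting along the edges lowers it. *)
Lemma line_code (R : realType) (n : nat) (A : quantum_sphere R n) (k : int) :
  exists c : idem (cp_alg A), gequiv k (ival c) (1%:M : 'M[A]_1).
Proof.
have up c d : gequiv d (ival c) (1%:M : 'M[A]_1) ->
    gequiv (1 + d) (ival (shift_idem c)) (1%:M : 'M[A]_1).
  by apply: gequiv_trans (gequiv_shift c); [exact: ival_cpidem | exact: cpidem_id].
have down (c : idem (cp_alg A)) d : gequiv d (ival c) (1%:M : 'M[A]_1) ->
    exists c' : idem (cp_alg A), gequiv (-1 + d) (ival c') (1%:M : 'M[A]_1).
  move=> h; have gc := edge_cut_cpidem (ival_cpidem c); have [c' hc'] := cpidem_code gc.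
  exists c'; rewrite -[-1]add0r -addrA; apply: gequiv_trans hc' _.
  - exact: ival_cpidem.
  - exact: cpidem_id.
  apply: gequiv_trans (gequiv_sym (edge_cut_gequiv (ival_cpidem c))) h => //.
  exact: cpidem_id.
have zero := cpidem_code (cpidem_id A 1).
elim/int_rect: k => [|m [c hc]|m [c hc]] //.
  by exists (shift_idem c); have := up _ _ hc; rewrite (_ : 1 + m%:Z = m.+1%:Z) //; lia.
by have [c' hc'] := down _ _ hc; exists c'; rewrite (_ : - m.+1%:Z = -1 - m%:Z) //; lia.
Qed.

Theorem corollary5p10 (R : realType) (n : nat) (A : quantum_sphere R n) :
  exists hL : forall k : int, mod_fgp (line_mod A k),
  exists (mul : K0 (cp_alg A) -> K0 (cp_alg A) -> K0 (cp_alg A))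
         (one : K0 (cp_alg A)),
    is_ring_structure mul one /\
    forall j k : int,
      mul (K0class (hL j)) (K0class (hL k)) = K0class (hL (j + k)).
Proof.
have hL k : mod_fgp (line_mod A k).
  by have [c /line_iso] := line_code A k; exact: mod_fgp_idem.
exists hL.
have cls_L k c : gequiv k (ival c) (1%:M : 'M[A]_1) -> K0class (hL k) = cls c.
  by move=> /line_iso h; rewrite /K0class (VclassE (hL k) h).
have shift_L k : K0shift (K0class (hL k)) = K0class (hL (k + 1)).
  have [c hc] := line_code A k; rewrite (cls_L k c hc) K0shift_cls.
  apply/esym/cls_L; rewrite addrC; apply: gequiv_trans (gequiv_shift c) hc.
    exact: ival_cpidem.
  exact: cpidem_id.
have gen (H : K0 (cp_alg A) -> Prop) : (forall x y, H x -> H y -> H (x - y)) ->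
    (forall x, H x -> H (K0shift x)) -> H (K0class (hL 0)) -> forall x, H x.
  move=> HB Hs H1; apply: K0_generated => // c hc.
  by rewrite -(cls_L 0 c hc).
have [mul h] := cyclic_ring (L := fun k => K0class (hL k)) (@K0shiftD R n A) shift_L gen.
by exists mul, (K0class (hL 0)).
Qed.
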